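(* Let $v\colon[0,1)\to(0,\infty)$ be a log-convex weight satisfying $\lim_{r\to1^-}v(r)=0$ and for which the differentiation operator $D\colon H^\infty_v\to H^\infty_w$ and the integration operator $J\colon H^\infty_w\to H^\infty_v$ are continuous, where $w(r):=(1-r)v(r)$ for $r\in[0,1)$. For each $t\in[0,1)$ the following statements are valid. (i) $[V_{g_t},H^\infty_v]=[C_t,H^\infty_v]=H^\infty_w$ as Banach spaces. (ii) $[V_{g_t},H^0_v]=[C_t,H^0_v]=H^0_w$ as Banach spaces. (iii) $H^\infty_v$ is a proper subspace of $[C_t,H^0_v]$ and hence, so is $H^0_v\subseteq H^\infty_v$.
   Context: $\mathbb{D}=\{z\in\mathbb{C}:|z|<1\}$; $H(\mathbb{D})$ is the Fréchet space of all analytic functions on $\mathbb{D}$ with the topology of uniform convergence on compact sets. $Df:=f'$ and $(Jf)(z):=\int_0^zf(\xi)\,d\xi$ for $f\in H(\mathbb{D})$. A weight is a continuous, non-increasing function $v\colon[0,1)\to(0,\infty)$, extended to $\mathbb{D}$ by $v(z):=v(|z|)$. It is log-convex if $x\mapsto -\log v(e^x)$ is convex on $(-\infty,0)$. Define $H^\infty_v:=\{f\in H(\mathbb{D}):\|f\|_{\infty,v}:=\sup_{z\in\mathbb{D}}|f(z)|v(z)<\infty\}$ and $H^0_v:=\{f\in H(\mathbb{D}):\lim_{|z|\to1^-}|f(z)|v(z)=0\}$, both with norm $\|\cdot\|_{\infty,v}$ (similarly for $w$). For $t\in(0,1]$ let $g_t(z):=-\frac{\mathrm{Log}(1-tz)}{t}$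 and let $g_0(z):=z$, for $z\in\mathbb{D}$. Thus $(V_{g_t}f)(z)=\int_0^z\frac{f(\xi)}{1-t\xi}\,d\xi$, and the generalized Cesàro operator $C_t$ is $(C_tf)(z):=\frac1z\int_0^z\frac{f(\xi)}{1-t\xi}\,d\xi$ for $z\in\mathbb{D}\setminus\{0\}$, $(C_tf)(0):=f(0)$, for $f\in H(\mathbb{D})$. For $X$ a Banach space continuously included in $H(\mathbb{D})$ and $T\colon H(\mathbb{D})\to H(\mathbb{D})$ continuous linear with $T(X)\subseteq X$, the optimal domain is $[T,X]:=\{f\in H(\mathbb{D}):Tf\in X\}$ with (semi-)norm $\|f\|_{[T,X]}:=\|Tf\|_X$. Equality ''as Banach spaces'' means equality as linear subspaces of $H(\mathbb{D})$ with equivalent complete norms. *)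

(* Defs.v *)
From Stdlib Require Import Reals.
From Coquelicot Require Import Coquelicot.

Open Scope R_scope.

(** An element of H(D) is represented by a total function [C -> C], of which
    only the values on the open unit disc matter: every notion below is
    insensitive to the values elsewhere. *)

Definition in_disc (z : C) : Prop := Cmod z < 1.

Definition eq_on_disc (f g : C -> C) : Prop :=
  forall z : C, in_disc z -> f z = g z.

Definition analytic (f : C -> C) : Prop :=
  forall z : C, in_disc z ->
    ex_derive (K := C_AbsRing) (V := C_NormedModule) f z.

Definition fzero : C -> C := fun _ => RtoC 0.
Definition fadd (f g : C -> C) : C -> C := fun z => Cplus (f z) (g z).
Definition fscal (a : C) (f : C -> C) : C -> C := fun z => Cmult a (f z).
Definition fsub (f g : C -> C) : C -> C := fun z => Cminus (f z) (g z).

(** [nrm f] is only meaningful when [carrier f] holds. *)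
Record normed_space : Type := NormedSpace {
  carrier : (C -> C) -> Prop;
  nrm : (C -> C) -> R
}.

Definition linear_subspace (P : (C -> C) -> Prop) : Prop :=
  (forall f, P f -> analytic f) /\
  P fzero /\
  (forall f g, P f -> P g -> P (fadd f g)) /\
  (forall a f, P f -> P (fscal a f)).

Definition is_norm (X : normed_space) : Prop :=
  (forall f, carrier X f -> 0 <= nrm X f) /\
  (forall f, carrier X f -> (nrm X f = 0 <-> eq_on_disc f fzero)) /\
  (forall a f, carrier X f -> nrm X (fscal a f) = Cmod a * nrm X f) /\
  (forall f g, carrier X f -> carrier X g ->
     nrm X (fadd f g) <= nrm X f + nrm X g).

Definition complete_norm (X : normed_space) : Prop :=
  forall u : nat -> C -> C,
    (forall n, carrier X (u n)) ->
    (forall eps, 0 < eps -> exists N : nat, forall m n : nat,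
       (N <= m)%nat -> (N <= n)%nat -> nrm X (fsub (u m) (u n)) < eps) ->
    exists f, carrier X f /\
      forall eps, 0 < eps -> exists N : nat, forall n : nat,
        (N <= n)%nat -> nrm X (fsub (u n) f) < eps.

Definition is_banach (X : normed_space) : Prop :=
  linear_subspace (carrier X) /\ is_norm X /\ complete_norm X.

Definition same_carrier (X Y : normed_space) : Prop :=
  forall f, carrier X f <-> carrier Y f.

Definition equivalent_norms (X Y : normed_space) : Prop :=
  exists c1 c2 : R, 0 < c1 /\ 0 < c2 /\
    forall f, carrier X f ->
      c1 * nrm X f <= nrm Y f /\ nrm Y f <= c2 * nrm X f.

Definition banach_eq (X Y : normed_space) : Prop :=
  is_banach X /\ is_banach Y /\ same_carrier X Y /\ equivalent_norms X Y.

Definition subspace_of (X Y : normed_space) : Prop :=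
  linear_subspace (carrier X) /\ linear_subspace (carrier Y) /\
  forall f, carrier X f -> carrier Y f.

Definition proper_subspace_of (X Y : normed_space) : Prop :=
  subspace_of X Y /\ exists f, carrier Y f /\ ~ carrier X f.

Definition continuous_operator
    (T : (C -> C) -> (C -> C)) (X Y : normed_space) : Prop :=
  (forall f, carrier X f -> carrier Y (T f)) /\
  (forall f, carrier X f -> forall eps, 0 < eps ->
     exists delta, 0 < delta /\
       forall g, carrier X g -> nrm X (fsub g f) < delta ->
         nrm Y (fsub (T g) (T f)) < eps).

(** The standing requirement that [T] map [X] into itself is not part of the
    definition; the set and its norm make sense without it. *)
Definition optimal_domain (T : (C -> C) -> (C -> C)) (X : normed_space)
    : normed_space :=
  NormedSpace (fun f => analytic f /\ carrier X (T f)) (fun f => nrm X (T f)).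

(** A weight is a function on [0,1); values of [v] outside [0,1) are junk, and
    continuity is relative to [0,1) (hence one-sided at 0). *)
Definition is_weight (v : R -> R) : Prop :=
  (forall r, 0 <= r < 1 -> 0 < v r) /\
  (forall r s, 0 <= r -> r <= s -> s < 1 -> v s <= v r) /\
  (forall r, 0 <= r < 1 ->
     filterlim v (within (fun s => 0 <= s < 1) (locally r)) (locally (v r))).

Definition log_convex (v : R -> R) : Prop :=
  forall x y lam : R, x < 0 -> y < 0 -> 0 <= lam <= 1 ->
    - ln (v (exp (lam * x + (1 - lam) * y)))
      <= lam * - ln (v (exp x)) + (1 - lam) * - ln (v (exp y)).

Definition weighted_sup (v : R -> R) (f : C -> C) : Rbar :=
  Lub_Rbar (fun x => exists z : C, in_disc z /\ x = Cmod (f z) * v (Cmod z)).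

(** The conversion [real] sends infinite values to 0, but the supremum is finite
    on the carriers of [Hinf v] and [Hzero v]. *)
Definition weighted_norm (v : R -> R) (f : C -> C) : R :=
  real (weighted_sup v f).

Definition Hinf (v : R -> R) : normed_space :=
  NormedSpace
    (fun f => analytic f /\ Rbar_lt (weighted_sup v f) p_infty)
    (weighted_norm v).

Definition Hzero (v : R -> R) : normed_space :=
  NormedSpace
    (fun f => analytic f /\
       forall eps, 0 < eps -> exists rho, rho < 1 /\
         forall z : C, rho < Cmod z < 1 -> Cmod (f z) * v (Cmod z) < eps)
    (weighted_norm v).

(** Integral along the segment [0,z]; for integrands analytic in the disc, this
    is the path-independent integral from 0 to z. *)
Definition integral_to (h : C -> C) (z : C) : C :=
  RInt (V := C_R_CompleteNormedModule)
    (fun s : R => Cmult z (h (Cmult (RtoC s) z))) 0 1.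

Definition Dop (f : C -> C) : C -> C := C_derive f.

Definition Jop (f : C -> C) : C -> C := integral_to f.

(** Principal argument, with values in (-PI, PI] and junk value 0 at 0. *)
Definition CArg (z : C) : R :=
  if Rlt_dec 0 (Re z) then atan (Im z / Re z)
  else if Rlt_dec (Re z) 0 then
    if Rle_dec 0 (Im z) then atan (Im z / Re z) + PI
    else atan (Im z / Re z) - PI
  else if Rlt_dec 0 (Im z) then PI / 2
  else if Rlt_dec (Im z) 0 then - (PI / 2)
  else 0.

Definition CLog (z : C) : C := (ln (Cmod z), CArg z).

Definition g_sym (t : R) (z : C) : C :=
  if Req_EM_T t 0 then z
  else Copp (Cdiv (CLog (Cminus (RtoC 1) (Cmult (RtoC t) z))) (RtoC t)).

Definition Volterra_op (g f : C -> C) : C -> C :=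
  integral_to (fun xi => Cmult (f xi) (C_derive g xi)).

Definition Cesaro_op (t : R) (f : C -> C) (z : C) : C :=
  if Ceq_dec z (RtoC 0) then f (RtoC 0)
  else Cmult (Cinv z)
    (integral_to
       (fun xi => Cdiv (f xi) (Cminus (RtoC 1) (Cmult (RtoC t) xi))) z).

(* Main.v *)
Require Import Defs.
From Stdlib Require Import Reals.
From Coquelicot Require Import Coquelicot.
From Stdlib Require Import Lra Lia Psatz ClassicalEpsilon FunctionalExtensionality.

Open Scope R_scope.

(** The continuity of [D] and [J] replaces Cauchy's theory. A dilation
    [z |-> f (r z)], [r < 1], of an analytic [f] is bounded, hence lies in
    [Hinf v] and [Hinf w]; so the mapping properties of [D] and [J] make [f'] and
    [Jf] analytic for every analytic [f], with [(Jf)' = f], and the boundedness of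
    [D] gives Cauchy estimates, hence the completeness of the weighted spaces.
    Dilations [f (r z)] of [f] in the little-o space converge to [f] in norm, so
    [D] and [J] also exchange [Hzero v] and [Hzero w].

    Since [g_t' = 1 / (1 - t z)] is bounded above and below on the disc,
    [V f = J (f g_t')] lies in the [v]-space iff [f] lies in the [w]-space. Moreover
    [V f = z (C_t f)], and [C_t f z] is the mean of [(V f)'] over the segment [0, z],
    which controls it near [0] where the division by [z] is singular.

    For (iii), [||n z^(n-1)||_w <= K ||z^n||_v] shows that the norms [v] and [w] are
    not comparable on monomials, and a lacunary series exploits this. *)

(** * Complex derivatives and integrals along segments *)

(** The usual order of argument is reversed. Path independence of the integral is not shown;
    analyticity of [Jop f] is known first, from the mapping property, and its derivative is then
    read off along a single direction, the radius through the point. Likewise [f'] is known to be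
    analytic, hence continuous, so increments of [f] are integrals of [f'] over segments. The
    resulting mean value inequality carries both the closure of analytic functions under limits and
    the approximation by dilations.

    Neither optimal domain is studied by itself. Each operator satisfies a two-sided estimate
    between the [w]-bound of [f] and the [v]-bound of its image, and the whole Banach structure is
    pulled back from the [w]-space through these estimates. *)

Notation is_cderive f z l :=
  (is_derive (K := C_AbsRing) (V := C_NormedModule) f z l).

(** Balls of [C_AbsRing] and the norm of [C_NormedModule] unfold to [Cmod], so the abstract
    differential is a first-order expansion up to conversion. Derivatives estimated by hand start
    from this form. *)
Lemma is_cderive_eps (f : C -> C) (z l : C) :
  is_cderive f z l <->
  forall eps, 0 < eps -> exists d, 0 < d /\ forall y : C, Cmod (y - z)%C < d ->
    Cmod (f y - f z - (y - z) * l)%C <= eps * Cmod (y - z)%C.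
Proof.
split.
- intros [_ H] eps He.
  specialize (H z (fun P HP => HP) (mkposreal eps He)).
  destruct H as [d Hd].
  exists d; split; [apply cond_pos|].
  intros y Hy. apply (Hd y). exact Hy.
- intros H; split; [apply is_linear_scal_l|].
  intros x Hx eps.
  rewrite <- (is_filter_lim_locally_unique _ _ Hx).
  destruct (H eps (cond_pos eps)) as [d [Hd H']].
  exists (mkposreal d Hd). intros y Hy. apply (H' y). exact Hy.
Qed.

Lemma norm_C_R (z : C) : @norm _ C_R_NormedModule z = Cmod z.
Proof. symmetry; apply Cmod_norm. Qed.

(** [C] carries two uniform structures here, that of [C_AbsRing] for complex derivatives and the
    product one for integrals over a real variable. A statement in [Cmod] alone can be fed to
    both. *)
Definition cont_at (f : C -> C) (z : C) :=
  forall eps, 0 < eps -> exists d, 0 < d /\ forall y : C, Cmod (y - z)%C < d ->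
    Cmod (f y - f z)%C < eps.

Lemma is_cderive_C_AbsRing (f : C -> C) (z l : C) :
  is_cderive f z l <-> is_derive (K := C_AbsRing) (V := AbsRing_NormedModule C_AbsRing) f z l.
Proof.
split; intros [_ H]; (split; [apply is_linear_scal_l | exact H]).
Qed.

Lemma is_cderive_cont_at (f : C -> C) (z l : C) : is_cderive f z l -> cont_at f z.
Proof.
rewrite is_cderive_C_AbsRing. intros H.
assert (Hc : continuous (T := AbsRing_UniformSpace C_AbsRing) (U := AbsRing_UniformSpace C_AbsRing) f z).
apply (ex_derive_continuous (K := C_AbsRing) (V := AbsRing_NormedModule C_AbsRing)). exists l; exact H.
intros eps He.
destruct (proj1 (filterlim_locally (U := AbsRing_UniformSpace C_AbsRing) f (f z)) Hc
  (mkposreal eps He)) as [d Hd].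
exists d; split; [apply cond_pos|]. exact Hd.
Qed.

Lemma continuous_C_R (f : R -> C) (s : R) :
  (forall eps, 0 < eps -> exists d, 0 < d /\ forall u : R, Rabs (u - s) < d ->
    Cmod (f u - f s)%C < eps) ->
  continuous (U := C_R_NormedModule) f s.
Proof.
intros H P HP.
apply (locally_norm_le_locally (V := C_R_NormedModule)) in HP as [eps HP].
destruct (H eps (cond_pos eps)) as [d [Hd H']].
exists (mkposreal d Hd). intros u Hu. apply HP. unfold ball_norm.
rewrite norm_C_R. apply (H' u Hu).
Qed.

Lemma is_derive_R_C (f : R -> C) (s : R) (l : C) :
  (forall eps, 0 < eps -> exists d, 0 < d /\ forall u : R, Rabs (u - s) < d ->
    Cmod (f u - f s - RtoC (u - s) * l)%C <= eps * Rabs (u - s)) ->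
  is_derive (V := C_R_NormedModule) f s l.
Proof.
intros H; split; [apply is_linear_scal_l|].
intros x Hx eps.
rewrite <- (is_filter_lim_locally_unique _ _ Hx).
destruct (H eps (cond_pos eps)) as [d [Hd H']].
exists (mkposreal d Hd). intros u Hu.
rewrite norm_C_R. specialize (H' u Hu).
change (Cmod (f u - f s - @scal R_Ring C_R_ModuleSpace (u - s)%R l)%C <= eps * Rabs (u - s)).
rewrite scal_R_Cmult. exact H'.
Qed.

(** A complex factor mixes real and imaginary parts, so the two components are integrated separately
    and recombined by the product formula. *)
Lemma is_RInt_Cmult (f : R -> C) (a b : R) (c l : C) :
  is_RInt (V := C_R_NormedModule) f a b l ->
  is_RInt (V := C_R_NormedModule) (fun s => c * f s)%C a b (c * l)%C.
Proof.
intros H.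
assert (H1 := is_RInt_fct_extend_fst (U := R_NormedModule) (V := R_NormedModule) f a b l H).
assert (H2 := is_RInt_fct_extend_snd (U := R_NormedModule) (V := R_NormedModule) f a b l H).
apply (is_RInt_fct_extend_pair (U := R_NormedModule) (V := R_NormedModule)).
- exact (is_RInt_minus _ _ _ _ _ _ (is_RInt_scal _ _ _ (fst c) _ H1)
           (is_RInt_scal _ _ _ (snd c) _ H2)).
- exact (is_RInt_plus _ _ _ _ _ _ (is_RInt_scal _ _ _ (fst c) _ H2)
           (is_RInt_scal _ _ _ (snd c) _ H1)).
Qed.

Lemma is_cderive_ext_disc (f g : C -> C) (z l : C) :
  eq_on_disc f g -> in_disc z -> is_cderive f z l -> is_cderive g z l.
Proof.
rewrite 2!is_cderive_eps. unfold eq_on_disc, in_disc. intros E Hz H eps He.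
destruct (H eps He) as [d [Hd H1]].
exists (Rmin d (1 - Cmod z)); split; [apply Rmin_pos; lra|].
intros y Hy.
assert (Hy1 : Cmod (y - z)%C < d) by (eapply Rlt_le_trans; [exact Hy | apply Rmin_l]).
assert (Hy2 : Cmod (y - z)%C < 1 - Cmod z) by (eapply Rlt_le_trans; [exact Hy | apply Rmin_r]).
rewrite <- (E z Hz), <- (E y). apply H1; trivial.
replace y with ((y - z) + z)%C by ring.
eapply Rle_lt_trans; [apply Cmod_triangle|]. lra.
Qed.

Lemma is_cderive_const (c z : C) : is_cderive (fun _ => c) z (RtoC 0).
Proof. exact (is_derive_const (K := C_AbsRing) (V := C_NormedModule) c z). Qed.

Lemma is_cderive_id (z : C) : is_cderive (fun x => x) z (RtoC 1).
Proof. apply is_cderive_C_AbsRing. exact (is_derive_id (K := C_AbsRing) z). Qed.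

Lemma is_cderive_mult (f g : C -> C) (z l m : C) :
  is_cderive f z l -> is_cderive g z m ->
  is_cderive (fun x => f x * g x)%C z (l * g z + f z * m)%C.
Proof.
rewrite 3!is_cderive_C_AbsRing. intros Hf Hg.
exact (is_derive_mult (K := C_AbsRing) f g z l m Hf Hg Cmult_comm).
Qed.

Lemma is_cderive_comp (f g : C -> C) (z l m : C) :
  is_cderive f (g z) l -> is_cderive g z m ->
  is_cderive (fun x => f (g x)) z (m * l)%C.
Proof.
rewrite (is_cderive_C_AbsRing g). intros Hf Hg.
exact (is_derive_comp (V := C_NormedModule) (K := C_AbsRing) f g z l m Hf Hg).
Qed.

Lemma is_cderive_comp_scale (f : C -> C) (c z l : C) :
  is_cderive f (c * z)%C l -> is_cderive (fun x => f (c * x)%C) z (c * l)%C.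
Proof.
intros H. apply (is_cderive_comp f (fun x => c * x)%C); trivial.
assert (D := is_cderive_mult (fun _ => c) (fun x => x) z _ _ (is_cderive_const c z) (is_cderive_id z)).
cbv beta in D. now replace (RtoC 0 * z + c * RtoC 1)%C with c in D by ring.
Qed.

Lemma is_cderive_plus (f g : C -> C) (z l m : C) :
  is_cderive f z l -> is_cderive g z m -> is_cderive (fun x => f x + g x)%C z (l + m)%C.
Proof. intros; apply (is_derive_plus (K := C_AbsRing) (V := C_NormedModule)); assumption. Qed.

Lemma is_cderive_inv (z : C) : z <> RtoC 0 -> is_cderive Cinv z (- / (z * z))%C.
Proof.
intros Hz. rewrite is_cderive_eps. intros eps He.
assert (Hm : 0 < Cmod z) by (apply Cmod_gt_0; trivial).
set (a := Cmod z) in *.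
(* The error term is [h^2 / (b a^2)], with [h], [b], [a] the moduli of [y - z], [y], [z]. The first
   radius gives [b >= a / 2]; the second then keeps the factor [h / (b a^2)] below [eps]. *)
exists (Rmin (a / 2) (eps * (a * a * a) / 2)); split.
{ apply Rmin_pos; [lra|]. apply Rdiv_lt_0_compat; [|lra]. repeat apply Rmult_lt_0_compat; lra. }
intros y Hy. apply Rmin_Rgt in Hy as [Hy1 Hy2].
assert (Hya : a / 2 <= Cmod y).
{ assert (a <= Cmod y + Cmod (y - z)%C); [|lra].
  unfold a. replace z with (y + - (y - z))%C at 1 by ring.
  rewrite <- (Cmod_opp (y - z)%C). apply Cmod_triangle. }
assert (Hy0 : y <> RtoC 0) by (apply Cmod_gt_0; lra).
replace (/ y - / z - (y - z) * - / (z * z))%C with ((y - z) * (y - z) * / (y * (z * z)))%C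
  by (field; auto).
rewrite !Cmod_mult, Cmod_inv by (repeat apply Cmult_neq_0; auto). rewrite !Cmod_mult.
fold a. set (h := Cmod (y - z)%C) in *. set (b := Cmod y) in *.
assert (Hh : 0 <= h) by apply Cmod_ge_0.
rewrite Rmult_assoc, (Rmult_comm eps). apply Rmult_le_compat_l; trivial.
apply (Rmult_le_reg_r (b * (a * a))); [apply Rmult_lt_0_compat; nra|].
rewrite Rmult_assoc, Rinv_l, Rmult_1_r by (apply Rgt_not_eq; apply Rmult_lt_0_compat; nra).
assert (0 < a * a) by nra.
apply Rle_trans with (eps * (a * a * a) / 2); [lra|].
replace (eps * (a * a * a) / 2) with (eps * (a / 2 * (a * a))) by field.
apply Rmult_le_compat_l; [lra|]. apply Rmult_le_compat_r; lra.
Qed.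

Lemma continuous_path (k : C -> C) (a b : C) (s : R) :
  cont_at k (a + RtoC s * b)%C ->
  continuous (U := C_R_NormedModule) (fun u : R => k (a + RtoC u * b)%C) s.
Proof.
intros H. apply continuous_C_R. intros eps He.
destruct (H eps He) as [d [Hd H']].
assert (Hb := Cmod_ge_0 b).
(* Adding 1 keeps the denominator positive when [b] is zero; the same device recurs below with other
   nonnegative bounds. *)
exists (d / (Cmod b + 1)); split; [apply Rdiv_lt_0_compat; lra|].
intros u Hu. apply H'.
replace (a + RtoC u * b - (a + RtoC s * b))%C with (RtoC (u - s) * b)%C
  by (rewrite RtoC_minus; ring).
rewrite Cmod_mult, Cmod_R.
apply (Rmult_lt_compat_r (Cmod b + 1)) in Hu; [|lra].
unfold Rdiv in Hu; rewrite Rmult_assoc, Rinv_l, Rmult_1_r in Hu by lra.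
generalize (Rabs_pos (u - s)); nra.
Qed.

Lemma is_derive_path (f : C -> C) (a b : C) (s : R) (l : C) :
  is_cderive f (a + RtoC s * b)%C l ->
  is_derive (V := C_R_NormedModule) (fun u : R => f (a + RtoC u * b)%C) s (b * l)%C.
Proof.
rewrite is_cderive_eps. intros H. apply is_derive_R_C. intros eps He.
assert (Hb := Cmod_ge_0 b).
destruct (H (eps / (Cmod b + 1))) as [d [Hd H1]]; [apply Rdiv_lt_0_compat; lra|].
exists (d / (Cmod b + 1)); split; [apply Rdiv_lt_0_compat; lra|].
intros u Hu.
assert (E : (a + RtoC u * b - (a + RtoC s * b) = RtoC (u - s) * b)%C)
  by (rewrite RtoC_minus; ring).
assert (Hu' : Cmod (a + RtoC u * b - (a + RtoC s * b))%C < d).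
{ rewrite E, Cmod_mult, Cmod_R. apply (Rmult_lt_compat_r (Cmod b + 1)) in Hu; [|lra].
  unfold Rdiv in Hu; rewrite Rmult_assoc, Rinv_l, Rmult_1_r in Hu by lra.
  generalize (Rabs_pos (u - s)); nra. }
specialize (H1 _ Hu').
rewrite E, Cmod_mult, Cmod_R in H1. rewrite Cmult_assoc.
eapply Rle_trans; [exact H1|].
rewrite (Rmult_comm (Rabs _)), <- Rmult_assoc.
apply Rmult_le_compat_r; [apply Rabs_pos|].
unfold Rdiv. rewrite Rmult_assoc. rewrite <- (Rmult_1_r eps) at 2.
apply Rmult_le_compat_l; [lra|]. apply (Rmult_le_reg_l (Cmod b + 1)); [lra|].
rewrite <- Rmult_assoc, Rinv_r by lra. lra.
Qed.

Lemma ex_RInt_path (k : C -> C) (a b : C) :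
  (forall s, 0 <= s <= 1 -> cont_at k (a + RtoC s * b)%C) ->
  ex_RInt (V := C_R_NormedModule) (fun u : R => k (a + RtoC u * b)%C) 0 1.
Proof.
intros H. apply (ex_RInt_continuous (V := C_R_CompleteNormedModule)).
rewrite Rmin_left, Rmax_right by lra. intros s Hs.
apply continuous_path. apply H, Hs.
Qed.

Lemma is_RInt_derive_path (f f' : C -> C) (a b : C) :
  (forall s, 0 <= s <= 1 -> is_cderive f (a + RtoC s * b)%C (f' (a + RtoC s * b)%C)) ->
  (forall s, 0 <= s <= 1 -> cont_at f' (a + RtoC s * b)%C) ->
  is_RInt (V := C_R_NormedModule) (fun u : R => b * f' (a + RtoC u * b))%C 0 1
    (f (a + b) - f a)%C.
Proof.
intros H H'.
replace (f (a + b) - f a)%C with (f (a + RtoC 1 * b) - f (a + RtoC 0 * b))%C.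
2:{ f_equal; f_equal; [|f_equal]; ring. }
apply (is_RInt_derive (V := C_R_CompleteNormedModule) (fun u : R => f (a + RtoC u * b)%C)
  (fun u => b * f' (a + RtoC u * b))%C);
  rewrite Rmin_left, Rmax_right by lra; intros s Hs.
- apply is_derive_path, H, Hs.
- apply (continuous_path (fun x => b * f' x)%C).
  intros eps He. assert (Hb := Cmod_ge_0 b).
  destruct (H' s Hs (eps / (Cmod b + 1))) as [d [Hd H1]]; [apply Rdiv_lt_0_compat; lra|].
  exists d; split; trivial. intros y Hy. specialize (H1 y Hy).
  replace (b * f' y - b * f' (a + s * b))%C with (b * (f' y - f' (a + s * b)))%C by ring.
  rewrite Cmod_mult.
  apply (Rmult_lt_compat_r (Cmod b + 1)) in H1; [|lra].
  unfold Rdiv in H1; rewrite Rmult_assoc, Rinv_l, Rmult_1_r in H1 by lra.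
  generalize (Cmod_ge_0 (f' y - f' (a + s * b))%C); nra.
Qed.

Lemma Cmod_segment (a b : C) (s r : R) :
  0 <= s <= 1 -> Cmod a <= r -> Cmod (a + b)%C <= r -> Cmod (a + RtoC s * b)%C <= r.
Proof.
intros Hs Ha Hb.
replace (a + RtoC s * b)%C with (RtoC (1 - s) * a + RtoC s * (a + b))%C
  by (rewrite RtoC_minus; ring).
eapply Rle_trans; [apply Cmod_triangle|]. rewrite !Cmod_mult, !Cmod_R.
rewrite !Rabs_pos_eq by lra. nra.
Qed.

(** The increment is the integral of [f'] over the segment from [a] to [z], which convexity keeps in
    the disc. This is where continuity of [f'] enters. *)
Lemma mean_value_disc (f f' : C -> C) (r M : R) (a z : C) :
  (forall y, Cmod y <= r -> is_cderive f y (f' y)) ->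
  (forall y, Cmod y <= r -> cont_at f' y) ->
  (forall y, Cmod y <= r -> Cmod (f' y) <= M) ->
  Cmod a <= r -> Cmod z <= r -> Cmod (f z - f a)%C <= Cmod (z - a)%C * M.
Proof.
intros Hf Hc HM Ha Hz.
assert (E : (a + (z - a) = z)%C) by ring.
assert (S : forall s, 0 <= s <= 1 -> Cmod (a + RtoC s * (z - a))%C <= r).
{ intros s Hs. apply Cmod_segment; trivial. rewrite E; trivial. }
assert (H := is_RInt_derive_path f f' a (z - a)%C (fun s Hs => Hf _ (S s Hs)) (fun s Hs => Hc _ (S s Hs))).
rewrite E in H. rewrite <- norm_C_R.
replace (Cmod (z - a)%C * M) with ((1 - 0) * (Cmod (z - a)%C * M)) by ring.
apply (norm_RInt_le_const (V := C_R_NormedModule) _ 0 1 _ _ Rle_0_1) with (2 := H).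
intros s Hs. rewrite norm_C_R, Cmod_mult. apply Rmult_le_compat_l; [apply Cmod_ge_0|]. auto.
Qed.

(* The radius [delta] attached to a point is at most the inverse of a local bound of
   [f], so a uniform lower bound for [delta] gives an upper bound for [f]. *)
Lemma bounded_on_disc (f : C -> C) (r : R) :
  (forall z, Cmod z <= r -> cont_at f z) ->
  exists M, 0 <= M /\ forall z, Cmod z <= r -> Cmod (f z) <= M.
Proof.
intros Hf.
assert (Hd : forall u v : R, exists d : posreal, forall z : C,
  Rabs (fst z - u) < d -> Rabs (snd z - v) < d -> Cmod z <= r -> Cmod (f z) <= / d).
{ intros u v.
  assert (B : forall z : C, forall d, Rabs (fst z - u) < d -> Rabs (snd z - v) < d ->
     Cmod (z - (u, v))%C < 2 * d).
  { intros z d H1 H2. eapply Rle_lt_trans; [apply Cmod_2Rmax|].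
    change (fst (z - (u, v))%C) with (fst z - u). change (snd (z - (u, v))%C) with (snd z - v).
    assert (Hmax : Rmax (Rabs (fst z - u)) (Rabs (snd z - v)) < d) by (apply Rmax_lub_lt; trivial).
    assert (0 <= Rmax (Rabs (fst z - u)) (Rabs (snd z - v))).
    { eapply Rle_trans; [apply Rabs_pos | apply Rmax_l]. }
    assert (sqrt 2 <= 2). { rewrite <- (sqrt_square 2) at 2 by lra. apply sqrt_le_1_alt; lra. }
    assert (0 <= sqrt 2) by apply sqrt_pos. nra. }
  destruct (Rle_dec (Cmod (u, v)) r) as [Hr|Hr].
  - destruct (Hf _ Hr 1 Rlt_0_1) as [d [Hd H]].
    assert (Hp : 0 < Cmod (f (u, v)) + 1) by (generalize (Cmod_ge_0 (f (u, v))); lra).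
    assert (Hm : 0 < Rmin (d / 2) (/ (Cmod (f (u, v)) + 1))).
    { apply Rmin_pos; [lra | apply Rinv_0_lt_compat; trivial]. }
    exists (mkposreal _ Hm). simpl. intros z H1 H2 _.
    assert (Hz : Cmod (z - (u, v))%C < d).
    { specialize (B z _ H1 H2). generalize (Rmin_l (d / 2) (/ (Cmod (f (u, v)) + 1))). lra. }
    specialize (H z Hz).
    apply Rle_trans with (Cmod (f (u, v)) + 1).
    + replace (f z) with ((f z - f (u, v)) + f (u, v))%C by ring.
      eapply Rle_trans; [apply Cmod_triangle|]. lra.
    + rewrite <- (Rinv_inv (Cmod (f (u, v)) + 1)) at 1. apply Rinv_le_contravar; trivial. apply Rmin_r.
  - assert (Hm : 0 < (Cmod (u, v) - r) / 2) by lra.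
    exists (mkposreal _ Hm). simpl. intros z H1 H2 Hz. specialize (B z _ H1 H2). exfalso.
    assert (Cmod (u, v) <= Cmod z + Cmod (z - (u, v))%C); [|lra].
    replace (u, v) with (z + - (z - (u, v)))%C at 1 by ring.
    rewrite <- (Cmod_opp (z - (u, v))%C). apply Cmod_triangle. }
set (delta := fun u v => proj1_sig (constructive_indefinite_description _ (Hd u v))).
destruct (compactness_value_2d (- r) r (- r) r delta) as [d H].
exists (/ d). split; [apply Rlt_le, Rinv_0_lt_compat, cond_pos|].
intros z Hz.
assert (Hm := Rmax_Cmod z).
assert (H1 : - r <= fst z <= r).
{ apply Rabs_le_between. eapply Rle_trans; [apply Rmax_l|]. eapply Rle_trans; eassumption. }
assert (H2 : - r <= snd z <= r).
{ apply Rabs_le_between. eapply Rle_trans; [apply Rmax_r|]. eapply Rle_trans; eassumption. }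
apply NNPP. intros N. apply (H (fst z) (snd z) H1 H2).
intros (u & v & _ & _ & Hu & Hv & Hl). apply N.
unfold delta in *. destruct (constructive_indefinite_description _ (Hd u v)) as [e He]; simpl in *.
eapply Rle_trans; [apply (He z); trivial|].
apply Rinv_le_contravar; trivial. apply cond_pos.
Qed.

(** * Algebra of analytic functions on the disc *)

Lemma analytic_is_cderive (f : C -> C) (z : C) :
  analytic f -> in_disc z -> is_cderive f z (C_derive f z).
Proof. intros Hf Hz. apply C_derive_correct; auto. Qed.

Lemma analytic_cont_at (f : C -> C) (z : C) : analytic f -> in_disc z -> cont_at f z.
Proof. intros Hf Hz. eapply is_cderive_cont_at, analytic_is_cderive; trivial. Qed.

Lemma analytic_bounded (f : C -> C) (r : R) :
  analytic f -> r < 1 -> exists M, 0 <= M /\ forall z, Cmod z <= r -> Cmod (f z) <= M.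
Proof.
intros Hf Hr. apply bounded_on_disc. intros z Hz. apply analytic_cont_at; trivial.
unfold in_disc; lra.
Qed.

Lemma analytic_ext (f g : C -> C) : eq_on_disc f g -> analytic f -> analytic g.
Proof.
intros E Hf z Hz. exists (C_derive f z).
eapply is_cderive_ext_disc; eauto using analytic_is_cderive.
Qed.

Lemma C_derive_ext (f g : C -> C) :
  analytic f -> eq_on_disc f g -> eq_on_disc (C_derive g) (C_derive f).
Proof.
intros Hf E z Hz. apply is_C_derive_unique.
eapply is_cderive_ext_disc; eauto using analytic_is_cderive.
Qed.

Lemma analytic_const (c : C) : analytic (fun _ => c).
Proof. intros z _. eexists. apply is_cderive_const. Qed.

Lemma analytic_id : analytic (fun z => z).
Proof. intros z _. eexists. apply is_cderive_id. Qed.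

Lemma analytic_mult (f g : C -> C) :
  analytic f -> analytic g -> analytic (fun z => f z * g z)%C.
Proof.
intros Hf Hg z Hz. eexists. apply is_cderive_mult; apply analytic_is_cderive; trivial.
Qed.

Lemma analytic_fadd (f g : C -> C) : analytic f -> analytic g -> analytic (fadd f g).
Proof.
intros Hf Hg z Hz. eexists. apply is_cderive_plus; apply analytic_is_cderive; trivial.
Qed.

Lemma analytic_fscal (c : C) (f : C -> C) : analytic f -> analytic (fscal c f).
Proof. intros Hf. apply (analytic_mult (fun _ => c)); trivial. apply analytic_const. Qed.

Lemma fsub_fadd (f g : C -> C) (z : C) : fadd f (fscal (RtoC (-1)) g) z = fsub f g z.
Proof. unfold fadd, fsub, fscal. ring. Qed.

Lemma analytic_fsub (f g : C -> C) : analytic f -> analytic g -> analytic (fsub f g).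
Proof.
intros Hf Hg. apply (analytic_ext (fadd f (fscal (RtoC (-1)) g))).
- intros z _. apply fsub_fadd.
- apply analytic_fadd; trivial. apply analytic_fscal; trivial.
Qed.

Lemma C_derive_fscal (c : C) (f : C -> C) :
  analytic f -> eq_on_disc (C_derive (fscal c f)) (fscal c (C_derive f)).
Proof.
intros Hf z Hz. apply is_C_derive_unique.
replace (fscal c (C_derive f) z) with (RtoC 0 * f z + c * C_derive f z)%C by (unfold fscal; ring).
apply (is_cderive_mult (fun _ => c)); [apply is_cderive_const | apply analytic_is_cderive; trivial].
Qed.

Lemma C_derive_fadd (f g : C -> C) :
  analytic f -> analytic g ->
  eq_on_disc (C_derive (fadd f g)) (fadd (C_derive f) (C_derive g)).
Proof.
intros Hf Hg z Hz. apply is_C_derive_unique.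
apply is_cderive_plus; apply analytic_is_cderive; trivial.
Qed.

Lemma C_derive_fsub (f g : C -> C) :
  analytic f -> analytic g ->
  eq_on_disc (C_derive (fsub f g)) (fsub (C_derive f) (C_derive g)).
Proof.
intros Hf Hg z Hz.
assert (Hs := analytic_fscal (RtoC (-1)) g Hg).
rewrite (C_derive_ext (fadd f (fscal (RtoC (-1)) g)) (fsub f g)); trivial.
- rewrite C_derive_fadd by trivial. unfold fadd. rewrite C_derive_fscal by trivial.
  unfold fscal, fsub. ring.
- apply analytic_fadd; trivial.
- intros y _. apply fsub_fadd.
Qed.

(** * Dilations of analytic functions *)

Definition dilate (r : R) (f : C -> C) : C -> C := fun z => f (RtoC r * z)%C.

Lemma Cmod_scale (r : R) (z : C) : 0 <= r -> Cmod (RtoC r * z)%C = r * Cmod z.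
Proof. intros Hr. rewrite Cmod_mult, Cmod_R, Rabs_pos_eq; trivial. Qed.

Lemma in_disc_scale (r : R) (z : C) : 0 <= r <= 1 -> in_disc z -> in_disc (RtoC r * z)%C.
Proof.
unfold in_disc. intros Hr Hz. rewrite Cmod_scale by lra. generalize (Cmod_ge_0 z); nra.
Qed.

Lemma is_cderive_dilate (r : R) (f : C -> C) (z : C) :
  0 <= r <= 1 -> analytic f -> in_disc z ->
  is_cderive (dilate r f) z (RtoC r * C_derive f (RtoC r * z))%C.
Proof.
intros Hr Hf Hz. apply is_cderive_comp_scale.
apply analytic_is_cderive; trivial. apply in_disc_scale; trivial.
Qed.

Lemma analytic_dilate (r : R) (f : C -> C) :
  0 <= r <= 1 -> analytic f -> analytic (dilate r f).
Proof. intros Hr Hf z Hz. eexists. apply is_cderive_dilate; trivial. Qed.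

(** * Weighted norms *)

(** Bounds replace norms in the estimates: [weighted_norm] passes through [real], which sends an
    infinite supremum to 0, so an inequality on it alone does not bound [f]. A bound [M] is
    meaningful for every function and is converted to the norm only at the end. *)
Definition bdd (v : R -> R) (f : C -> C) (M : R) : Prop :=
  forall z, in_disc z -> Cmod (f z) * v (Cmod z) <= M.

Lemma in_disc_0 : in_disc (RtoC 0).
Proof. unfold in_disc. rewrite Cmod_0; lra. Qed.

Lemma Hinf_bdd (v : R -> R) (f : C -> C) :
  carrier (Hinf v) f -> bdd v f (weighted_norm v f).
Proof.
intros [_ H] z Hz. unfold weighted_norm, weighted_sup in *.
destruct (Lub_Rbar_correct
  (fun x => exists z : C, in_disc z /\ x = Cmod (f z) * v (Cmod z))) as [U _].
assert (Uz := U _ (ex_intro _ z (conj Hz eq_refl))).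
destruct (Lub_Rbar _) as [l| |]; simpl in *; try contradiction. exact Uz.
Qed.

Lemma bdd_weighted_sup (v : R -> R) (f : C -> C) (M : R) :
  bdd v f M -> Rbar_le (weighted_sup v f) M.
Proof.
intros H. apply Lub_Rbar_correct. intros x [z [Hz ->]]. apply H, Hz.
Qed.

Lemma bdd_Hinf (v : R -> R) (f : C -> C) (M : R) :
  analytic f -> bdd v f M -> carrier (Hinf v) f.
Proof.
intros Hf H. split; trivial. eapply Rbar_le_lt_trans; [apply bdd_weighted_sup, H | exact I].
Qed.

Lemma bdd_weighted_norm (v : R -> R) (f : C -> C) (M : R) :
  bdd v f M -> weighted_norm v f <= M.
Proof.
intros H. assert (L := bdd_weighted_sup v f M H).
unfold weighted_norm. destruct (weighted_sup v f) as [l| |] eqn:E; simpl in *; try contradiction; trivial.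
(* Only [m_infty] is left, whose [real] value 0 need not lie below [M]. The value at the origin
   belongs to the set and rules this case out. *)
unfold weighted_sup in E.
destruct (Lub_Rbar_correct
  (fun x => exists z : C, in_disc z /\ x = Cmod (f z) * v (Cmod z))) as [U _].
rewrite E in U. elim (U _ (ex_intro _ (RtoC 0) (conj in_disc_0 eq_refl))).
Qed.

(** Common to [v] and [w], so that each lemma on weighted spaces serves both. *)
Definition vanishing (v : R -> R) : Prop :=
  (forall r, 0 <= r < 1 -> 0 < v r) /\
  (forall r s, 0 <= r -> r <= s -> s < 1 -> v s <= v r) /\
  (forall eps, 0 < eps -> exists rho, 0 <= rho < 1 /\ forall r, rho < r < 1 -> v r < eps).

Lemma Cmod_disc (z : C) : in_disc z -> 0 <= Cmod z < 1.
Proof. split; trivial. apply Cmod_ge_0. Qed.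

Lemma weighted_norm_ge_0 (v : R -> R) (f : C -> C) :
  vanishing v -> carrier (Hinf v) f -> 0 <= weighted_norm v f.
Proof.
intros [Hv _] H. eapply Rle_trans; [|apply (Hinf_bdd _ _ H _ in_disc_0)].
apply Rmult_le_pos; [apply Cmod_ge_0|]. apply Rlt_le, Hv, Cmod_disc, in_disc_0.
Qed.

Lemma bdd_fadd (v : R -> R) (f g : C -> C) (M N : R) :
  vanishing v -> bdd v f M -> bdd v g N -> bdd v (fadd f g) (M + N).
Proof.
intros [Hv _] Hf Hg z Hz. specialize (Hf z Hz). specialize (Hg z Hz).
specialize (Hv _ (Cmod_disc z Hz)).
assert (T := Cmod_triangle (f z) (g z)). unfold fadd. nra.
Qed.

Lemma bdd_fscal (v : R -> R) (f : C -> C) (c : C) (M : R) :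
  bdd v f M -> bdd v (fscal c f) (Cmod c * M).
Proof.
intros Hf z Hz. unfold fscal. rewrite Cmod_mult, Rmult_assoc.
apply Rmult_le_compat_l; [apply Cmod_ge_0 | auto].
Qed.

Lemma bdd_ext (v : R -> R) (f g : C -> C) (M : R) :
  eq_on_disc f g -> bdd v f M -> bdd v g M.
Proof. intros E H z Hz. rewrite <- E by trivial. auto. Qed.

Lemma bdd_le (v : R -> R) (f : C -> C) (M N : R) : M <= N -> bdd v f M -> bdd v f N.
Proof. intros L H z Hz. specialize (H z Hz). lra. Qed.

Lemma bdd_fsub (v : R -> R) (f g : C -> C) (M N : R) :
  vanishing v -> bdd v f M -> bdd v g N -> bdd v (fsub f g) (M + N).
Proof.
intros Hv Hf Hg. apply (bdd_ext _ (fadd f (fscal (RtoC (-1)) g))).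
- intros z _; apply fsub_fadd.
- apply bdd_fadd; trivial. rewrite <- (Rmult_1_l N).
  replace 1 with (Cmod (RtoC (-1))); [apply bdd_fscal; trivial|].
  rewrite Cmod_R, Rabs_left; lra.
Qed.

Lemma weighted_norm_ext (v : R -> R) (f g : C -> C) :
  eq_on_disc f g -> weighted_norm v f = weighted_norm v g.
Proof.
intros E. unfold weighted_norm, weighted_sup. f_equal. apply Lub_Rbar_eqset.
intros x; split; intros [z [Hz ->]]; exists z; rewrite E by trivial; auto.
Qed.

Lemma Hinf_is_norm (v : R -> R) : vanishing v -> is_norm (Hinf v).
Proof.
intros Hv. assert (Hp := proj1 Hv).
split; [intros f; apply weighted_norm_ge_0; trivial|].
split; [|split]; simpl nrm.
- intros f Hf. split.
  + intros E z Hz. assert (B := Hinf_bdd _ _ Hf z Hz). rewrite E in B.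
    specialize (Hp _ (Cmod_disc z Hz)). assert (P := Cmod_ge_0 (f z)).
    apply Cmod_eq_0. nra.
  + intros E. apply Rle_antisym; [|apply weighted_norm_ge_0; trivial].
    apply bdd_weighted_norm. intros z Hz. rewrite E by trivial. unfold fzero. rewrite Cmod_0. lra.
- intros c f Hf. apply Rle_antisym.
  + apply bdd_weighted_norm, bdd_fscal, Hinf_bdd, Hf.
  (* For nonzero [c] the reverse inequality is the direct one for the factor [/ c], applied to
     [fscal c f]. *)
  + destruct (Ceq_dec c (RtoC 0)) as [->|Hc].
    * rewrite Cmod_0, Rmult_0_l. apply weighted_norm_ge_0; trivial.
      eapply bdd_Hinf; [apply analytic_fscal, Hf | apply bdd_fscal, Hinf_bdd, Hf].
    * assert (Hc' : 0 < Cmod c) by (apply Cmod_gt_0; trivial).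
      apply (Rmult_le_reg_l (/ Cmod c)); [apply Rinv_0_lt_compat; trivial|].
      rewrite <- Rmult_assoc, Rinv_l, Rmult_1_l by lra.
      rewrite <- Cmod_inv by trivial.
      apply bdd_weighted_norm. apply (bdd_ext _ (fscal (/ c)%C (fscal c f))).
      { intros z _. unfold fscal. field. trivial. }
      apply bdd_fscal, Hinf_bdd.
      eapply bdd_Hinf; [apply analytic_fscal, Hf | apply bdd_fscal, Hinf_bdd, Hf].
- intros f g Hf Hg. apply bdd_weighted_norm, bdd_fadd; trivial; apply Hinf_bdd; trivial.
Qed.

Lemma Hzero_Hinf (v : R -> R) (f : C -> C) :
  vanishing v -> carrier (Hzero v) f -> carrier (Hinf v) f.
Proof.
intros (Hp & Hm & _) [Hf H].
destruct (H 1 Rlt_0_1) as [rho [Hr H1]].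
destruct (analytic_bounded f rho Hf Hr) as [M [HM B]].
(* The summand 1 covers the annulus beyond [rho], from the little-o condition with [eps = 1]. The
   other covers the inner disc, where [f] is bounded by compactness and the weight is at most
   [v 0]. *)
apply (bdd_Hinf _ _ (1 + M * v 0)); trivial.
intros z Hz. destruct (Cmod_disc z Hz) as [Hz0 Hz1].
assert (0 < v 0) by (apply Hp; lra).
destruct (Rle_dec (Cmod z) rho) as [L|L].
- assert (v (Cmod z) <= v 0) by (apply Hm; lra).
  assert (0 < v (Cmod z)) by (apply Hp; lra).
  specialize (B z L). assert (P := Cmod_ge_0 (f z)). nra.
- specialize (H1 z). nra.
Qed.

Lemma bounded_Hzero (v : R -> R) (f : C -> C) (M : R) :
  vanishing v -> analytic f -> (forall z, in_disc z -> Cmod (f z) <= M) -> carrier (Hzero v) f.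
Proof.
intros (Hp & _ & Hl) Hf HM. split; trivial. intros eps He.
assert (M0 : 0 <= M).
{ eapply Rle_trans; [apply Cmod_ge_0 | apply (HM _ in_disc_0)]. }
destruct (Hl (eps / (M + 1))) as [rho [Hr H]]; [apply Rdiv_lt_0_compat; lra|].
exists rho; split; [lra|]. intros z Hz.
specialize (H (Cmod z) Hz). assert (HMz := HM z (proj2 Hz)).
assert (0 < v (Cmod z)) by (apply Hp; lra).
apply (Rmult_lt_compat_r (M + 1)) in H; [|lra].
unfold Rdiv in H; rewrite Rmult_assoc, Rinv_l, Rmult_1_r in H by lra.
assert (P := Cmod_ge_0 (f z)). nra.
Qed.

Lemma analytic_fzero : analytic fzero.
Proof. apply analytic_const. Qed.

Lemma Hinf_linear (v : R -> R) : vanishing v -> linear_subspace (carrier (Hinf v)).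
Proof.
intros Hv. split; [|split; [|split]].
- intros f H; apply H.
- apply (bdd_Hinf _ _ 0); [apply analytic_fzero|]. intros z Hz. unfold fzero. rewrite Cmod_0; lra.
- intros f g Hf Hg. eapply bdd_Hinf; [apply analytic_fadd; [apply Hf | apply Hg]|].
  apply bdd_fadd; trivial; apply Hinf_bdd; trivial.
- intros c f Hf. eapply bdd_Hinf; [apply analytic_fscal, Hf | apply bdd_fscal, Hinf_bdd, Hf].
Qed.

Lemma Hzero_linear (v : R -> R) : vanishing v -> linear_subspace (carrier (Hzero v)).
Proof.
intros Hv. assert (Hp := proj1 Hv). split; [|split; [|split]].
- intros f H; apply H.
- apply (bounded_Hzero _ _ 0); trivial; [apply analytic_fzero|].
  intros z Hz. unfold fzero. rewrite Cmod_0; lra.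
- intros f g [Hf Ef] [Hg Eg]. split; [apply analytic_fadd; trivial|].
  intros eps He. destruct (Ef (eps / 2)) as [r1 [H1 E1]]; [lra|].
  destruct (Eg (eps / 2)) as [r2 [H2 E2]]; [lra|].
  exists (Rmax r1 r2). split; [apply Rmax_lub_lt; trivial|].
  intros z Hz. generalize (Rmax_l r1 r2) (Rmax_r r1 r2). intros.
  specialize (E1 z ltac:(lra)). specialize (E2 z ltac:(lra)).
  assert (0 < v (Cmod z)) by (apply Hp, Cmod_disc, Hz).
  assert (T := Cmod_triangle (f z) (g z)). unfold fadd. nra.
- intros c f [Hf Ef]. split; [apply analytic_fscal; trivial|].
  intros eps He. assert (Hc := Cmod_ge_0 c).
  destruct (Ef (eps / (Cmod c + 1))) as [r [H E]]; [apply Rdiv_lt_0_compat; lra|].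
  exists r; split; trivial. intros z Hz. specialize (E z Hz).
  assert (0 < v (Cmod z)) by (apply Hp, Cmod_disc, Hz).
  unfold fscal. rewrite Cmod_mult.
  apply (Rmult_lt_compat_r (Cmod c + 1)) in E; [|lra].
  unfold Rdiv in E; rewrite (Rmult_assoc eps), Rinv_l, Rmult_1_r in E by lra.
  assert (P := Cmod_ge_0 (f z)). assert (0 <= Cmod (f z) * v (Cmod z)) by nra. nra.
Qed.

(** The bound [M] need not be the norm, so estimates can be chained without computing a supremum.
    Analyticity of [T f] is tracked separately. *)
Definition bounded_on (T : (C -> C) -> C -> C) (a b : R -> R) : Prop :=
  exists K, 0 < K /\ forall f M, analytic f -> bdd a f M -> bdd b (T f) (K * M).

Lemma bdd_ge_0 (v : R -> R) (f : C -> C) (M : R) : vanishing v -> bdd v f M -> 0 <= M.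
Proof.
intros [Hv _] H. eapply Rle_trans; [|apply (H _ in_disc_0)].
apply Rmult_le_pos; [apply Cmod_ge_0|]. apply Rlt_le, Hv, Cmod_disc, in_disc_0.
Qed.

(** Continuity at the zero function with [eps = 1] gives a radius [d]. Scaling [f] to norm at most
    [d / 2] and undoing the scaling by homogeneity yields the constant [2 / d]. *)
Lemma continuous_operator_bounded (T : (C -> C) -> C -> C) (a b : R -> R) :
  vanishing a -> vanishing b ->
  (forall c f, analytic f -> eq_on_disc (T (fscal c f)) (fscal c (T f))) ->
  continuous_operator T (Hinf a) (Hinf b) -> bounded_on T a b.
Proof.
intros Ha Hb Hom [Hc Hcont].
(* Zero is written as a multiple, so that homogeneity alone shows that [T f0] vanishes on the
   disc. *)
set (f0 := fscal (RtoC 0) fzero).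
assert (B0 : bdd a f0 0).
{ intros z _. unfold f0, fscal, fzero. rewrite Cmult_0_r, Cmod_0. lra. }
assert (F0 : carrier (Hinf a) f0).
{ eapply bdd_Hinf; [apply analytic_fscal, analytic_fzero | exact B0]. }
destruct (Hcont f0 F0 1 Rlt_0_1) as [d [Hd H]].
exists (2 / d). split; [apply Rdiv_lt_0_compat; lra|].
assert (Main : forall f M, analytic f -> 0 < M -> bdd a f M -> bdd b (T f) (2 / d * M)).
{ intros f M Hf HM B z Hz.
  set (c := d / (2 * M)). assert (c_pos : 0 < c) by (apply Rdiv_lt_0_compat; lra).
  set (g := fscal (RtoC c) f).
  assert (Bg : bdd a g (d / 2)).
  { replace (d / 2) with (Cmod (RtoC c) * M).
    - apply bdd_fscal; trivial.
    - rewrite Cmod_R, Rabs_pos_eq by lra. unfold c. field. lra. }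
  assert (Hg : carrier (Hinf a) g).
  { eapply bdd_Hinf; [apply analytic_fscal; trivial | exact Bg]. }
  assert (Hn : nrm (Hinf a) (fsub g f0) < d).
  { apply Rle_lt_trans with (d / 2 + 0); [|lra].
    apply bdd_weighted_norm, bdd_fsub; trivial. }
  specialize (H g Hg Hn).
  assert (E : eq_on_disc (fsub (T g) (T f0)) (fscal (RtoC c) (T f))).
  { intros y Hy. unfold fsub, f0, g. rewrite !Hom; trivial; [|apply analytic_fzero].
    unfold fscal. ring. }
  assert (Hs : carrier (Hinf b) (fsub (T g) (T f0))).
  { destruct (Hc g Hg) as [A1 _]. destruct (Hc f0 F0) as [A2 _].
    eapply bdd_Hinf; [apply analytic_fsub; trivial|].
    apply bdd_fsub; trivial; apply Hinf_bdd; auto. }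
  assert (Bz := Hinf_bdd _ _ Hs z Hz). rewrite E in Bz by trivial.
  unfold fscal in Bz. rewrite Cmod_mult, Cmod_R, Rabs_pos_eq in Bz by lra.
  simpl in H.
  apply (Rmult_le_reg_l c); trivial. replace (c * (2 / d * M)) with 1 by (unfold c; field; lra).
  lra. }
(* The scaling factor needs a positive bound; [M = 0] is reached by enlarging [M] and letting the
   excess tend to 0. *)
intros f M Hf B z Hz. assert (HM := bdd_ge_0 _ _ _ Ha B).
apply le_epsilon. intros eps He.
assert (Hd2 : 0 < 2 / d) by (apply Rdiv_lt_0_compat; lra).
assert (He' : 0 < eps / (2 / d)) by (apply Rdiv_lt_0_compat; lra).
replace (2 / d * M + eps) with (2 / d * (M + eps / (2 / d))) by (field; lra).
apply Main; trivial; [lra|]. eapply bdd_le; [|exact B]. lra.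
Qed.

(** * Consequences of the continuity of [D] and [J] *)

(** Analyticity is local: for [r] strictly between [Cmod z] and 1, the point [z / r] lies in the
    disc, and near [z] the function is its dilation by [r] precomposed with division by [r]. *)
Lemma analytic_undilate (f : C -> C) :
  (forall r, 0 < r < 1 -> analytic (dilate r f)) -> analytic f.
Proof.
intros H z Hz. assert (P := Cmod_disc z Hz).
set (r := (1 + Cmod z) / 2). assert (Hr : 0 < r < 1) by (unfold r; lra).
assert (Hr0 : RtoC r <> RtoC 0) by (intros E; apply RtoC_inj in E; lra).
assert (Hd : in_disc (/ RtoC r * z)%C).
{ unfold in_disc. rewrite <- RtoC_inv, Cmod_scale by (try apply Rlt_le, Rinv_0_lt_compat; lra).
  apply (Rmult_lt_reg_l r); [lra|]. rewrite <- Rmult_assoc, Rinv_r by lra. unfold r; lra. }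
eexists.
eapply (is_derive_ext (K := C_AbsRing) (V := C_NormedModule)
  (fun y => dilate r f (/ RtoC r * y)%C)).
- intros y. unfold dilate. f_equal. field; trivial.
- apply is_cderive_comp_scale, analytic_is_cderive; [apply H|]; trivial.
Qed.

Lemma dilate_bounded (r : R) (f : C -> C) :
  analytic f -> 0 <= r < 1 ->
  exists M, 0 <= M /\ forall z, in_disc z -> Cmod (dilate r f z) <= M.
Proof.
intros Hf Hr. destruct (analytic_bounded f r Hf) as [M [HM H]]; [lra|].
exists M; split; trivial. intros z Hz. apply H. rewrite Cmod_scale by lra.
unfold in_disc in Hz. generalize (Cmod_ge_0 z); nra.
Qed.

Lemma dilate_Hzero (v : R -> R) (r : R) (f : C -> C) :
  vanishing v -> analytic f -> 0 <= r < 1 -> carrier (Hzero v) (dilate r f).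
Proof.
intros Hv Hf Hr. destruct (dilate_bounded r f Hf Hr) as [M [_ H]].
apply (bounded_Hzero _ _ M); trivial. apply analytic_dilate; trivial; lra.
Qed.

Lemma analytic_C_derive (v w : R -> R) :
  vanishing v -> (forall f, carrier (Hinf v) f -> carrier (Hinf w) (Dop f)) ->
  forall f, analytic f -> analytic (C_derive f).
Proof.
intros Hv HD f Hf. apply analytic_undilate. intros r Hr.
apply (analytic_ext (fscal (/ RtoC r)%C (C_derive (dilate r f)))).
- intros z Hz. unfold fscal.
  rewrite (is_C_derive_unique _ _ _ (is_cderive_dilate r f z ltac:(lra) Hf Hz)).
  unfold dilate. field. intros E; apply RtoC_inj in E; lra.
- apply analytic_fscal.
  apply (HD (dilate r f)), Hzero_Hinf; trivial. apply dilate_Hzero; trivial. lra.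
Qed.

Lemma cont_on_segment (k : C -> C) (z : C) (s : R) :
  analytic k -> in_disc z -> 0 <= s <= 1 -> cont_at k (RtoC s * z)%C.
Proof. intros Hk Hz Hs. apply analytic_cont_at; trivial. apply in_disc_scale; trivial. Qed.

(** This is [integral_to] with its factor [z] removed. Unlike a quotient by [z], the mean has a
    value at the origin, namely [k (RtoC 0)], which absorbs the case distinction of the Cesaro
    operator. *)
Definition radial_mean (k : C -> C) (z : C) : C :=
  RInt (V := C_R_CompleteNormedModule) (fun s => k (RtoC s * z)%C) 0 1.

Lemma is_RInt_radial_mean (k : C -> C) (z : C) :
  analytic k -> in_disc z ->
  is_RInt (V := C_R_NormedModule) (fun s => k (RtoC s * z)%C) 0 1 (radial_mean k z).
Proof.
intros Hk Hz. apply (RInt_correct (V := C_R_CompleteNormedModule)).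
eapply ex_RInt_ext; [|apply (ex_RInt_path k (RtoC 0) z)].
- intros s _. simpl. now rewrite Cplus_0_l.
- intros s Hs. rewrite Cplus_0_l. apply cont_on_segment; trivial.
Qed.

Lemma is_RInt_integral_to (k : C -> C) (z : C) :
  analytic k -> in_disc z ->
  is_RInt (V := C_R_NormedModule) (fun s => z * k (RtoC s * z))%C 0 1 (z * radial_mean k z)%C.
Proof. intros Hk Hz. apply is_RInt_Cmult, is_RInt_radial_mean; trivial. Qed.

Lemma integral_to_radial_mean (k : C -> C) (z : C) :
  analytic k -> in_disc z -> integral_to k z = (z * radial_mean k z)%C.
Proof.
intros Hk Hz. unfold integral_to. apply (is_RInt_unique (V := C_R_CompleteNormedModule)).
apply is_RInt_integral_to; trivial.
Qed.

Lemma integral_to_ext (k h : C -> C) (z : C) :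
  eq_on_disc k h -> in_disc z -> integral_to k z = integral_to h z.
Proof.
intros E Hz. unfold integral_to. apply (RInt_ext (V := C_R_CompleteNormedModule)).
rewrite Rmin_left, Rmax_right by lra. intros s Hs. rewrite E; trivial.
apply in_disc_scale; trivial. lra.
Qed.

Lemma Cmod_RInt_le (f : R -> C) (l : C) (M : R) :
  (forall s, 0 <= s <= 1 -> Cmod (f s) <= M) ->
  is_RInt (V := C_R_NormedModule) f 0 1 l -> Cmod l <= M.
Proof.
intros HM H. rewrite <- norm_C_R. replace M with ((1 - 0) * M) by ring.
apply (norm_RInt_le_const (V := C_R_NormedModule) f 0 1); trivial; [lra|].
intros s Hs. rewrite norm_C_R. auto.
Qed.

Lemma radial_mean_le (k : C -> C) (z : C) (M : R) :
  analytic k -> in_disc z -> (forall y, Cmod y <= Cmod z -> Cmod (k y) <= M) ->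
  Cmod (radial_mean k z) <= M.
Proof.
intros Hk Hz HM. apply Cmod_RInt_le with (2 := is_RInt_radial_mean k z Hk Hz).
intros s Hs. apply HM. rewrite Cmod_scale by lra. generalize (Cmod_ge_0 z); nra.
Qed.

Lemma integral_to_fscal (c : C) (k : C -> C) :
  analytic k -> eq_on_disc (integral_to (fscal c k)) (fscal c (integral_to k)).
Proof.
intros Hk z Hz. unfold fscal at 2. rewrite (integral_to_radial_mean k) by trivial.
unfold integral_to. apply (is_RInt_unique (V := C_R_CompleteNormedModule)).
eapply is_RInt_ext;
  [|apply (is_RInt_Cmult (fun s => z * k (RtoC s * z))%C 0 1 c), is_RInt_integral_to; trivial].
intros s _. unfold fscal. simpl. ring.
Qed.

Lemma integral_to_fadd (h k : C -> C) :
  analytic h -> analytic k ->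
  eq_on_disc (integral_to (fadd h k)) (fadd (integral_to h) (integral_to k)).
Proof.
intros Hh Hk z Hz. transitivity (z * radial_mean (fadd h k) z)%C.
{ apply integral_to_radial_mean; trivial. apply analytic_fadd; trivial. }
transitivity (z * radial_mean h z + z * radial_mean k z)%C.
2:{ symmetry. apply (f_equal2 Cplus); apply integral_to_radial_mean; trivial. }
rewrite <- Cmult_plus_distr_l. apply f_equal. unfold radial_mean at 1.
apply (is_RInt_unique (V := C_R_CompleteNormedModule)).
apply (is_RInt_plus (V := C_R_NormedModule)); apply is_RInt_radial_mean; trivial.
Qed.

Lemma analytic_Jop (v w : R -> R) :
  vanishing w -> (forall f, carrier (Hinf w) f -> carrier (Hinf v) (Jop f)) ->
  forall f, analytic f -> analytic (Jop f).
Proof.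
intros Hw HJ f Hf. apply analytic_undilate. intros r Hr.
assert (Hdf : analytic (dilate r f)) by (apply analytic_dilate; trivial; lra).
(* The value of [Jop f] at [r z] is [r] times the value of [Jop (dilate r f)] at [z]. *)
apply (analytic_ext (fscal (RtoC r) (Jop (dilate r f)))).
- intros z Hz. unfold fscal, dilate at 2, Jop.
  rewrite integral_to_radial_mean by trivial.
  rewrite integral_to_radial_mean by (trivial; apply in_disc_scale; trivial; lra).
  rewrite Cmult_assoc. apply f_equal. unfold radial_mean.
  apply (RInt_ext (V := C_R_CompleteNormedModule)). intros s _. unfold dilate. f_equal. ring.
- apply analytic_fscal. apply HJ, Hzero_Hinf; trivial. apply dilate_Hzero; trivial. lra.
Qed.

Lemma is_derive_R_C_unique (f : R -> C) (s : R) (l m : C) :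
  is_derive (V := C_R_NormedModule) f s l -> is_derive (V := C_R_NormedModule) f s m -> l = m.
Proof.
assert (E : forall l, is_derive (V := C_R_NormedModule) f s l -> forall eps, 0 < eps ->
  exists d, 0 < d /\ forall u : R, Rabs (u - s) < d ->
    Cmod (f u - f s - RtoC (u - s) * l)%C <= eps * Rabs (u - s)).
{ intros k [_ H] eps He. specialize (H s (fun P HP => HP) (mkposreal eps He)).
  destruct H as [d Hd]. exists d; split; [apply cond_pos|]. intros u Hu.
  specialize (Hd u Hu). rewrite norm_C_R in Hd.
  change (Cmod (f u - f s - @scal R_Ring C_R_ModuleSpace (u - s)%R k)%C
    <= eps * Rabs (u - s)) in Hd.
  rewrite scal_R_Cmult in Hd. exact Hd. }
intros Hl Hm.
assert (Z : Cmod (l - m)%C <= 0).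
{ apply le_epsilon. intros eps He. rewrite Rplus_0_l.
  destruct (E l Hl (eps / 2)) as [d1 [Hd1 H1]]; [lra|].
  destruct (E m Hm (eps / 2)) as [d2 [Hd2 H2]]; [lra|].
  set (h := Rmin d1 d2 / 2).
  assert (Hmin : 0 < Rmin d1 d2) by (apply Rmin_pos; trivial).
  assert (Hh : 0 < h) by (unfold h; lra).
  assert (Ra : Rabs (s + h - s) = h) by (replace (s + h - s) with h by ring; apply Rabs_pos_eq; lra).
  specialize (H1 (s + h)). specialize (H2 (s + h)). rewrite Ra in H1, H2.
  generalize (Rmin_l d1 d2) (Rmin_r d1 d2). intros.
  specialize (H1 ltac:(unfold h; lra)). specialize (H2 ltac:(unfold h; lra)).
  apply (Rmult_le_reg_l h); trivial. rewrite <- (Rabs_pos_eq h) at 1 by lra.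
  rewrite <- Cmod_R, <- Cmod_mult.
  replace (RtoC h * (l - m))%C with
    ((f (s + h)%R - f s - RtoC (s + h - s) * m) + - (f (s + h)%R - f s - RtoC (s + h - s) * l))%C.
  - eapply Rle_trans; [apply Cmod_triangle|]. rewrite Cmod_opp. lra.
  - replace (s + h - s) with h by ring. ring. }
assert (P := Cmod_ge_0 (l - m)%C).
apply Ceq_minus, Cmod_eq_0. lra.
Qed.

(** Since [F = integral_to k] is already complex differentiable, one direction determines its
    derivative. At [u = 1] the path [F (u z)] has derivative [z F'(z)] by the chain rule and
    [z k(z)] by the fundamental theorem of calculus, and [z] cancels. At the origin nothing can be
    cancelled; there the equality follows from continuity of [F'] and [k]. *)
Lemma C_derive_integral_to (k : C -> C) :
  analytic k -> analytic (integral_to k) -> analytic (C_derive (integral_to k)) ->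
  eq_on_disc (C_derive (integral_to k)) k.
Proof.
intros Hk HF HF'.
assert (Off0 : forall z, in_disc z -> z <> RtoC 0 -> C_derive (integral_to k) z = k z).
{ intros z Hz Hz0.
  assert (E : (z * C_derive (integral_to k) z = z * k z)%C).
  2:{ rewrite <- (Cmult_1_l (C_derive _ _)), <- (Cmult_1_l (k z)), <- (Cinv_l z) by trivial.
      rewrite <- !Cmult_assoc, E. reflexivity. }
  apply (is_derive_R_C_unique (fun u => integral_to k (RtoC u * z)%C) 1).
  - eapply is_derive_ext; [|apply (is_derive_path (integral_to k) (RtoC 0) z)].
    + intros u. simpl. now rewrite Cplus_0_l.
    + replace (RtoC 0 + RtoC 1 * z)%C with z by ring. apply analytic_is_cderive; trivial.
  - replace (z * k z)%C with (z * k (RtoC 1 * z))%C by (now rewrite Cmult_1_l).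
    apply (is_derive_RInt (V := C_R_NormedModule) (fun u => z * k (RtoC u * z))%C _ 0 1).
    + destruct (Cmod_disc z Hz) as [Hz1 Hz2].
      assert (Hp : 0 < (1 - Cmod z) / 2) by lra.
      exists (mkposreal _ Hp). intros x Hx.
      change (Rabs (x - 1) < (1 - Cmod z) / 2) in Hx. apply Rabs_def2 in Hx.
      assert (Hx0 : 0 < x) by lra.
      assert (Hxz : in_disc (RtoC x * z)%C).
      { unfold in_disc. rewrite Cmod_scale by lra. nra. }
      rewrite integral_to_radial_mean by trivial.
      assert (HI := is_RInt_integral_to k _ Hk Hxz).
      (* The endpoints are prepared for the linear substitution [s = u / x], which turns the
         integral over [[0, 1]] at the point [x z] into one over [[0, x]] at [z]. *)
      replace 0 with (/ x * 0 + 0) in HI by ring.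
      replace 1 with (/ x * x + 0) in HI by (field; lra).
      apply is_RInt_comp_lin in HI.
      eapply is_RInt_ext; [|exact HI]. intros u _. cbv beta.
      match goal with |- @scal _ _ ?a ?b = _ =>
        change (@eq C (@scal R_Ring C_R_ModuleSpace a b) (z * k (RtoC u * z))%C) end.
      rewrite scal_R_Cmult. rewrite Rplus_0_r, RtoC_mult, RtoC_inv by lra.
      replace (/ RtoC x * RtoC u * (RtoC x * z))%C with (RtoC u * z)%C.
      * field. intros E; apply RtoC_inj in E; lra.
      * field. intros E; apply RtoC_inj in E; lra.
    + eapply continuous_ext; [|apply (continuous_path (fun y => z * k y)%C (RtoC 0) z)].
      * intros u. simpl. now rewrite Cplus_0_l.
      * replace (RtoC 0 + RtoC 1 * z)%C with z by ring.
        apply analytic_cont_at; trivial. apply (analytic_fscal z); trivial. }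
intros z Hz. destruct (Ceq_dec z (RtoC 0)) as [->|Hz0]; [|auto].
apply Ceq_minus, Cmod_eq_0. apply Rle_antisym; [|apply Cmod_ge_0].
apply le_epsilon. intros eps He. rewrite Rplus_0_l.
destruct (analytic_cont_at _ _ HF' in_disc_0 (eps / 2)) as [d1 [Hd1 H1]]; [lra|].
destruct (analytic_cont_at _ _ Hk in_disc_0 (eps / 2)) as [d2 [Hd2 H2]]; [lra|].
set (h := Rmin (Rmin d1 d2) 1 / 2).
assert (Hm : 0 < Rmin (Rmin d1 d2) 1) by (repeat apply Rmin_pos; lra).
generalize (Rmin_l (Rmin d1 d2) 1) (Rmin_r (Rmin d1 d2) 1) (Rmin_l d1 d2) (Rmin_r d1 d2). intros.
assert (Hh : 0 < h) by (unfold h; lra).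
assert (Ra : Cmod (RtoC h) = h) by (rewrite Cmod_R; apply Rabs_pos_eq; lra).
specialize (H1 (RtoC h)). specialize (H2 (RtoC h)).
replace (RtoC h - RtoC 0)%C with (RtoC h) in H1, H2 by ring. rewrite Ra in H1, H2.
specialize (H1 ltac:(unfold h; lra)). specialize (H2 ltac:(unfold h; lra)).
rewrite Off0 in H1.
- set (D := C_derive (integral_to k) (RtoC 0)) in *.
  replace (D - k (RtoC 0))%C with ((k (RtoC h) - k (RtoC 0)) + - (k (RtoC h) - D))%C by ring.
  eapply Rle_trans; [apply Cmod_triangle|]. rewrite Cmod_opp. lra.
- unfold in_disc. rewrite Ra. unfold h; lra.
- intros E; apply RtoC_inj in E; lra.
Qed.

(** * Cauchy estimates and completeness of the weighted spaces *)

Definition derivatives_analytic : Prop := forall f, analytic f -> analytic (C_derive f).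

Lemma cauchy_estimate (v w : R -> R) (r s : R) :
  vanishing v -> vanishing w -> bounded_on Dop v w -> 0 <= r < s -> s < 1 ->
  exists K, 0 < K /\ forall f M, analytic f -> (forall z, Cmod z <= s -> Cmod (f z) <= M) ->
    forall z, Cmod z <= r -> Cmod (C_derive f z) <= K * M.
Proof.
intros (Hv & Hvm & _) (Hw & Hwm & _) [K [HK H]] Hr Hs.
assert (Hrs : 0 <= r / s < 1).
{ split; [apply Rmult_le_pos; [|apply Rlt_le, Rinv_0_lt_compat]; lra|].
  apply (Rmult_lt_reg_r s); [lra|]. unfold Rdiv. rewrite Rmult_assoc, Rinv_l by lra. lra. }
assert (W : 0 < w (r / s)) by (apply Hw; trivial).
assert (V : 0 < v 0) by (apply Hv; lra).
(* The dilation by [s] has [v]-bound [M * v 0]. At [x = z / s], where the weight is at least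
   [w (r / s)], the bound on [Dop] reads [s * |f'(z)| * w (r / s) <= K * (M * v 0)]. *)
exists (K * v 0 / (s * w (r / s))).
split; [apply Rdiv_lt_0_compat; apply Rmult_lt_0_compat; lra|].
intros f M Hf HM z Hz.
assert (B : bdd v (dilate s f) (M * v 0)).
{ intros y Hy. destruct (Cmod_disc y Hy). unfold dilate.
  apply Rmult_le_compat; [apply Cmod_ge_0 | apply Rlt_le, Hv; lra | | apply Hvm; lra].
  apply HM. rewrite Cmod_scale by lra. nra. }
assert (s0 : RtoC s <> RtoC 0) by (intros E; apply RtoC_inj in E; lra).
set (x := (RtoC (/ s) * z)%C).
assert (Cx : Cmod x = Cmod z / s).
{ unfold x. rewrite Cmod_scale by (apply Rlt_le, Rinv_0_lt_compat; lra). unfold Rdiv. ring. }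
assert (Cx' : Cmod x <= r / s).
{ rewrite Cx. unfold Rdiv. apply Rmult_le_compat_r; trivial. apply Rlt_le, Rinv_0_lt_compat; lra. }
assert (Hx : in_disc x) by (unfold in_disc; lra).
specialize (H (dilate s f) _ (analytic_dilate s f ltac:(lra) Hf) B x Hx).
unfold Dop in H.
rewrite (is_C_derive_unique _ _ _ (is_cderive_dilate s f x ltac:(lra) Hf Hx)) in H.
replace (RtoC s * x)%C with z in H by (unfold x; rewrite RtoC_inv by lra; field; trivial).
rewrite Cmod_scale in H by lra.
assert (w (r / s) <= w (Cmod x)) by (apply Hwm; [apply Cmod_ge_0 | trivial | lra]).
assert (P := Cmod_ge_0 (C_derive f z)).
apply (Rmult_le_reg_r (s * w (r / s))); [apply Rmult_lt_0_compat; lra|].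
replace (K * v 0 / (s * w (r / s)) * M * (s * w (r / s))) with (K * (M * v 0)) by (field; split; lra).
eapply Rle_trans; [|exact H].
rewrite <- Rmult_assoc, (Rmult_comm (Cmod (C_derive f z)) s).
apply Rmult_le_compat_l; trivial. apply Rmult_le_pos; lra.
Qed.

Lemma C_cauchy_lim (a : nat -> C) :
  (forall eps, 0 < eps -> exists N, forall m n, (N <= m)%nat -> (N <= n)%nat ->
     Cmod (a m - a n)%C < eps) ->
  exists l : C, forall eps, 0 < eps -> exists N, forall n, (N <= n)%nat -> Cmod (a n - l)%C < eps.
Proof.
intros H.
assert (L1 : exists x, Un_cv (fun n => fst (a n)) x).
{ assert (CC : Cauchy_crit (fun n => fst (a n))); [|destruct (Rcomplete.R_complete _ CC) as [x Hx]; exists x; exact Hx].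
  intros eps He. destruct (H eps He) as [N HN]. exists N. intros m n Hm Hn.
  eapply Rle_lt_trans; [|apply (HN m n); lia]. unfold Rdist.
  eapply Rle_trans; [|apply Rmax_Cmod]. apply Rmax_l. }
assert (L2 : exists x, Un_cv (fun n => snd (a n)) x).
{ assert (CC : Cauchy_crit (fun n => snd (a n))); [|destruct (Rcomplete.R_complete _ CC) as [x Hx]; exists x; exact Hx].
  intros eps He. destruct (H eps He) as [N HN]. exists N. intros m n Hm Hn.
  eapply Rle_lt_trans; [|apply (HN m n); lia]. unfold Rdist.
  eapply Rle_trans; [|apply Rmax_Cmod]. apply Rmax_r. }
destruct L1 as [x Hx]. destruct L2 as [y Hy]. exists (x, y). intros eps He.
destruct (Hx (eps / 2)) as [N1 H1]; [lra|]. destruct (Hy (eps / 2)) as [N2 H2]; [lra|].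
exists (Nat.max N1 N2). intros n Hn.
specialize (H1 n ltac:(lia)). specialize (H2 n ltac:(lia)). unfold Rdist in *.
eapply Rle_lt_trans; [apply Cmod_2Rmax|].
change (fst (a n - (x, y))%C) with (fst (a n) - x). change (snd (a n - (x, y))%C) with (snd (a n) - y).
assert (Hmax : Rmax (Rabs (fst (a n) - x)) (Rabs (snd (a n) - y)) < eps / 2) by (apply Rmax_lub_lt; trivial).
assert (0 <= Rmax (Rabs (fst (a n) - x)) (Rabs (snd (a n) - y))).
{ eapply Rle_trans; [apply Rabs_pos | apply Rmax_l]. }
assert (sqrt 2 <= 2). { rewrite <- (sqrt_square 2) at 2 by lra. apply sqrt_le_1_alt; lra. }
assert (0 <= sqrt 2) by apply sqrt_pos. nra.
Qed.

Definition locally_uniformly_cauchy (u : nat -> C -> C) : Prop :=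
  forall r, r < 1 -> forall eps, 0 < eps -> exists N, forall m n, (N <= m)%nat -> (N <= n)%nat ->
    forall z, Cmod z <= r -> Cmod (fsub (u m) (u n) z) <= eps.

Definition pointwise_limit (u : nat -> C -> C) (f : C -> C) : Prop :=
  forall z, in_disc z -> forall eps, 0 < eps -> exists N, forall n, (N <= n)%nat ->
    Cmod (u n z - f z)%C < eps.

(* The difference quotients of [u n] converge uniformly in [n], since by the
   Cauchy estimates the derivatives are uniformly Cauchy near [z]. *)
Lemma analytic_limit (v w : R -> R) (u : nat -> C -> C) (f : C -> C) :
  vanishing v -> vanishing w -> bounded_on Dop v w -> derivatives_analytic ->
  (forall n, analytic (u n)) -> locally_uniformly_cauchy u -> pointwise_limit u f ->
  analytic f.
Proof.
intros Hv Hw HD Hder Hu Huc Hlim z Hz.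
assert (Pz := Cmod_disc z Hz).
(* Two radii, since the Cauchy estimate controls derivatives only on a smaller disc: [r] leaves room
   around [z], and [s] leaves room beyond [r]. *)
set (r := (1 + Cmod z) / 2). set (s := (1 + r) / 2).
assert (Hr : 0 <= r < s) by (unfold s, r; lra). assert (Hs : s < 1) by (unfold s, r; lra).
destruct (cauchy_estimate v w r s Hv Hw HD Hr Hs) as [K [HK CE]].
assert (HC : forall eps, 0 < eps -> exists N, forall m n, (N <= m)%nat -> (N <= n)%nat ->
  forall y, Cmod y <= r -> Cmod (C_derive (fsub (u m) (u n)) y) <= eps).
{ intros eps He. destruct (Huc s Hs (eps / K)) as [N HN]; [apply Rdiv_lt_0_compat; lra|].
  exists N. intros m n Hm Hn y Hy. replace eps with (K * (eps / K)) by (field; lra).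
  apply CE; trivial; [apply analytic_fsub; trivial|]. apply HN; trivial. }
destruct (C_cauchy_lim (fun n => C_derive (u n) z)) as [l Hl].
{ intros eps He. destruct (HC (eps / 2)) as [N HN]; [lra|]. exists N. intros m n Hm Hn.
  specialize (HN m n Hm Hn z ltac:(unfold r; lra)).
  rewrite C_derive_fsub in HN by trivial. unfold fsub in HN. lra. }
exists l. apply is_cderive_eps. intros eps He.
destruct (HC (eps / 3)) as [N1 H1]; [lra|].
destruct (Hl (eps / 3)) as [N2 H2]; [lra|].
set (N := Nat.max N1 N2).
assert (HdN := analytic_is_cderive (u N) z (Hu N) Hz). rewrite is_cderive_eps in HdN.
destruct (HdN (eps / 3)) as [d [Hd H3]]; [lra|].
exists (Rmin d (r - Cmod z)). split; [apply Rmin_pos; unfold r; lra|].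
intros y Hy. apply Rmin_Rgt in Hy as [Hy1 Hy2].
assert (Hyr : Cmod y <= r).
{ replace y with ((y - z) + z)%C by ring. eapply Rle_trans; [apply Cmod_triangle|]. lra. }
assert (Hyd : in_disc y) by (unfold in_disc; lra).
assert (Hzr : Cmod z <= r) by (unfold r; lra).
(* The mean value inequality for [u m - u N], with [m] sent to infinity. Only [N] remains, so the
   expansion of the single function [u N] at [z] suffices. *)
assert (Q : Cmod ((f y - u N y) - (f z - u N z))%C <= Cmod (y - z)%C * (eps / 3)).
{ apply le_epsilon. intros e Hee.
  destruct (Hlim y Hyd (e / 2)) as [Na HNa]; [lra|].
  destruct (Hlim z Hz (e / 2)) as [Nb HNb]; [lra|].
  set (m := Nat.max N1 (Nat.max Na Nb)).
  specialize (HNa m ltac:(lia)). specialize (HNb m ltac:(lia)).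
  assert (A : analytic (fsub (u m) (u N))) by (apply analytic_fsub; trivial).
  assert (MV := mean_value_disc (fsub (u m) (u N)) (C_derive (fsub (u m) (u N))) r (eps / 3) z y).
  assert (Cmod (fsub (u m) (u N) y - fsub (u m) (u N) z)%C <= Cmod (y - z)%C * (eps / 3)).
  { apply MV; trivial.
    - intros x Hx. apply analytic_is_cderive; trivial. unfold in_disc; lra.
    - intros x Hx. apply analytic_cont_at; [apply Hder; trivial|]. unfold in_disc; lra.
    - apply H1; lia. }
  unfold fsub in *.
  replace ((f y - u N y) - (f z - u N z))%C with
   ((u m y - u N y - (u m z - u N z)) + (- (u m y - f y) + (u m z - f z)))%C by ring.
  eapply Rle_trans; [apply Cmod_triangle|].
  assert (T := Cmod_triangle (- (u m y - f y))%C (u m z - f z)%C). rewrite Cmod_opp in T. lra. }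
specialize (H3 y Hy1). specialize (H2 N ltac:(lia)).
replace (f y - f z - (y - z) * l)%C with
  ((f y - u N y - (f z - u N z)) + ((u N y - u N z - (y - z) * C_derive (u N) z)
    + (y - z) * (C_derive (u N) z - l)))%C by ring.
eapply Rle_trans; [apply Cmod_triangle|].
eapply Rle_trans; [apply Rplus_le_compat_l, Cmod_triangle|]. rewrite Cmod_mult.
assert (P := Cmod_ge_0 (y - z)%C). nra.
Qed.

Definition cauchy_in (w : R -> R) (u : nat -> C -> C) : Prop :=
  forall eps, 0 < eps -> exists N : nat, forall m n : nat,
    (N <= m)%nat -> (N <= n)%nat -> bdd w (fsub (u m) (u n)) eps.

Definition limit_in (w : R -> R) (u : nat -> C -> C) (f : C -> C) : Prop :=
  forall eps, 0 < eps -> exists N : nat, forall n : nat,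
    (N <= n)%nat -> bdd w (fsub (u n) f) eps.

(** For [Cmod z <= r] the weight is at least [w r], so a Cauchy sequence for the weighted bounds is
    uniformly Cauchy on smaller discs and has an analytic limit. The weighted estimate survives the
    limit because it is checked one point at a time. *)
Lemma cauchy_limit (v w : R -> R) (u : nat -> C -> C) :
  vanishing v -> vanishing w -> bounded_on Dop v w -> derivatives_analytic ->
  (forall n, analytic (u n)) -> cauchy_in w u ->
  exists f, analytic f /\ limit_in w u f.
Proof.
intros Hv Hw HD Hder Hu HC. destruct Hw as (Hp & Hm & Hl) eqn:Ew.
assert (L : locally_uniformly_cauchy u).
{ intros r Hr eps He. destruct (Rle_dec 0 r) as [Hr0|Hr0].
  - assert (W : 0 < w r) by (apply Hp; lra).
    destruct (HC (eps * w r)) as [N HN]; [apply Rmult_lt_0_compat; lra|].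
    exists N. intros m n Hm' Hn z Hz. specialize (HN m n Hm' Hn z ltac:(unfold in_disc; lra)).
    assert (w r <= w (Cmod z)) by (apply Hm; trivial; apply Cmod_ge_0).
    assert (P := Cmod_ge_0 (fsub (u m) (u n) z)).
    apply (Rmult_le_reg_r (w r)); trivial. nra.
  - exists O. intros m n _ _ z Hz. generalize (Cmod_ge_0 z). lra. }
(* The limit is asserted for every [z], with an arbitrary value outside the disc, so that choice
   yields a total function. *)
assert (E : forall z, exists l : C, in_disc z -> forall eps, 0 < eps -> exists N, forall n,
  (N <= n)%nat -> Cmod (u n z - l)%C < eps).
{ intros z. destruct (Rlt_dec (Cmod z) 1) as [Hz|Hz].
  - destruct (C_cauchy_lim (fun n => u n z)) as [l Hl'].
    + intros eps He. destruct (L (Cmod z) Hz (eps / 2)) as [N HN]; [lra|].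
      exists N. intros m n Hm' Hn. specialize (HN m n Hm' Hn z (Rle_refl _)).
      unfold fsub in HN. lra.
    + exists l. auto.
  - exists (RtoC 0). intros Hz'. contradiction. }
set (f := fun z => proj1_sig (constructive_indefinite_description _ (E z))).
assert (Pf : pointwise_limit u f).
{ intros z Hz. unfold f. destruct (constructive_indefinite_description _ (E z)) as [l Hl']. auto. }
exists f. split; [apply (analytic_limit v w u f); trivial|].
intros eps He. destruct (HC eps He) as [N HN]. exists N. intros n Hn z Hz.
assert (W : 0 < w (Cmod z)) by (apply Hp, Cmod_disc, Hz).
apply le_epsilon. intros e Hee.
destruct (Pf z Hz (e / w (Cmod z))) as [N' HN']; [apply Rdiv_lt_0_compat; lra|].
set (m := Nat.max N N').
specialize (HN' m ltac:(lia)). specialize (HN n m Hn ltac:(lia) z Hz).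
unfold fsub in *. replace (u n z - f z)%C with ((u n z - u m z) + (u m z - f z))%C by ring.
apply (Rmult_lt_compat_r (w (Cmod z))) in HN'; trivial.
unfold Rdiv in HN'. rewrite Rmult_assoc, Rinv_l in HN' by lra.
assert (T := Cmod_triangle (u n z - u m z) (u m z - f z)). nra.
Qed.

Lemma limit_Hinf (w : R -> R) (u : nat -> C -> C) (f : C -> C) :
  vanishing w -> analytic f -> (forall n, carrier (Hinf w) (u n)) -> limit_in w u f ->
  carrier (Hinf w) f.
Proof.
intros Hw Hf Hu HL. destruct (HL 1 Rlt_0_1) as [N HN]. specialize (HN N (le_n _)).
eapply bdd_Hinf; trivial. apply (bdd_ext _ (fsub (u N) (fsub (u N) f))).
- intros z _. unfold fsub. ring.
- apply bdd_fsub; [trivial | apply Hinf_bdd, Hu | exact HN].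
Qed.

(** Half of [eps] pays for the approximation and half for the little-o condition on [g]. Closedness
    serves three times: for completeness, for images of dilations, and for the sum of the lacunary
    series. *)
Lemma Hzero_closed (w : R -> R) (f : C -> C) :
  vanishing w -> analytic f ->
  (forall eps, 0 < eps -> exists g, carrier (Hzero w) g /\ bdd w (fsub g f) eps) ->
  carrier (Hzero w) f.
Proof.
intros [Hp _] Hf H. split; trivial. intros eps He.
destruct (H (eps / 2)) as [g [[_ Hg] B]]; [lra|].
destruct (Hg (eps / 2)) as [r [Hr Hg']]; [lra|].
exists r; split; trivial. intros z Hz. specialize (Hg' z Hz). specialize (B z (proj2 Hz)).
assert (W : 0 < w (Cmod z)) by (apply Hp, Cmod_disc, Hz).
replace (f z) with (g z + - fsub g f z)%C by (unfold fsub; ring).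
assert (T := Cmod_triangle (g z) (- fsub g f z)). rewrite Cmod_opp in T. nra.
Qed.

Lemma nrm_cauchy_in (X : normed_space) (w : R -> R) (u : nat -> C -> C) :
  vanishing w -> (forall f, carrier X f -> carrier (Hinf w) f) -> nrm X = weighted_norm w ->
  (forall n, carrier X (u n)) ->
  (forall eps, 0 < eps -> exists N : nat, forall m n : nat,
       (N <= m)%nat -> (N <= n)%nat -> nrm X (fsub (u m) (u n)) < eps) ->
  cauchy_in w u.
Proof.
intros Hw HX En Hu HC eps He. destruct (HC eps He) as [N HN]. exists N.
intros m n Hm Hn. specialize (HN m n Hm Hn). rewrite En in HN.
eapply bdd_le; [apply Rlt_le, HN|]. apply Hinf_bdd.
assert (Am := HX _ (Hu m)). assert (An := HX _ (Hu n)).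
eapply bdd_Hinf; [apply analytic_fsub; [apply Am | apply An]|].
apply bdd_fsub; trivial; apply Hinf_bdd; trivial.
Qed.

Lemma limit_in_nrm (w : R -> R) (u : nat -> C -> C) (f : C -> C) :
  limit_in w u f -> forall eps, 0 < eps -> exists N : nat, forall n : nat,
        (N <= n)%nat -> weighted_norm w (fsub (u n) f) < eps.
Proof.
intros HL eps He. destruct (HL (eps / 2)) as [N HN]; [lra|]. exists N. intros n Hn.
apply Rle_lt_trans with (eps / 2); [|lra]. apply bdd_weighted_norm; auto.
Qed.

Lemma Hinf_banach (v w : R -> R) :
  vanishing v -> vanishing w -> bounded_on Dop v w -> derivatives_analytic ->
  is_banach (Hinf w).
Proof.
intros Hv Hw HD Hder. split; [apply Hinf_linear; trivial|].
split; [apply Hinf_is_norm; trivial|].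
intros u Hu HC. apply (nrm_cauchy_in _ w) in HC; trivial.
destruct (cauchy_limit v w u) as [f [Hf HL]]; trivial; [apply Hu|].
exists f. split; [apply (limit_Hinf _ u); trivial|]. apply limit_in_nrm; trivial.
Qed.

Lemma Hzero_banach (v w : R -> R) :
  vanishing v -> vanishing w -> bounded_on Dop v w -> derivatives_analytic ->
  is_banach (Hzero w).
Proof.
intros Hv Hw HD Hder. split; [apply Hzero_linear; trivial|].
assert (HI := fun f => Hzero_Hinf w f Hw).
split.
{ destruct (Hinf_is_norm w Hw) as (N1 & N2 & N3 & N4).
  split; [|split; [|split]]; simpl nrm; intros; [apply N1 | apply N2 | apply N3 | apply N4]; auto. }
intros u Hu HC. apply (nrm_cauchy_in _ w) in HC; trivial.
destruct (cauchy_limit v w u) as [f [Hf HL]]; trivial; [apply Hu|].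
exists f. split; [|apply limit_in_nrm; trivial].
apply Hzero_closed; trivial. intros eps He. destruct (HL eps He) as [N HN].
exists (u N). split; [apply Hu | apply HN, le_n].
Qed.

(** On [Cmod z <= s] the mean value inequality applies, with [f'] bounded there. Beyond [s], the
    value [f z] is small by the little-o condition. If the dilated point still lies beyond [r1], so
    is the other value, as the weight at that point dominates [w (Cmod z)]; otherwise [f] is bounded
    by [M] there and [w (Cmod z)] is small because [Cmod z] exceeds [r2]. *)
Lemma dilate_approx (w : R -> R) (f : C -> C) (eps : R) :
  vanishing w -> derivatives_analytic -> carrier (Hzero w) f -> 0 < eps ->
  exists r, 0 < r < 1 /\ bdd w (fsub (dilate r f) f) eps.
Proof.
intros (Hp & Hm & Hl) Hder [Hf H0] He.
destruct (H0 (eps / 2)) as [r1 [Hr1 H1]]; [lra|].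
destruct (analytic_bounded f r1 Hf Hr1) as [M [HM B]].
destruct (Hl (eps / (2 * (M + 1)))) as [r2 [Hr2 H2]]; [apply Rdiv_lt_0_compat; lra|].
set (s := Rmax r1 r2).
assert (Hs : s < 1) by (apply Rmax_lub_lt; lra).
assert (Hs1 : r1 <= s) by apply Rmax_l. assert (Hs2 : r2 <= s) by apply Rmax_r.
destruct (analytic_bounded _ s (Hder f Hf) Hs) as [M' [HM' B']].
assert (W0 : 0 < w 0) by (apply Hp; lra).
assert (HMw : 0 <= M' * w 0) by (apply Rmult_le_pos; lra).
(* The dilation factor is [1 - d]. The mean value inequality on the inner disc gives an error of at
   most [d * M' * w 0], which this choice keeps below [eps]. *)
set (d := Rmin (1 / 2) (eps / (M' * w 0 + 1))).
assert (Hd : 0 < d) by (apply Rmin_pos; [lra | apply Rdiv_lt_0_compat; lra]).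
assert (Hd1 : d <= 1 / 2) by apply Rmin_l.
assert (Hd2 : d * (M' * w 0) <= eps).
{ assert (d <= eps / (M' * w 0 + 1)) by apply Rmin_r.
  apply Rle_trans with (d * (M' * w 0 + 1)); [nra|].
  replace eps with (eps / (M' * w 0 + 1) * (M' * w 0 + 1)) by (field; lra).
  apply Rmult_le_compat_r; lra. }
exists (1 - d). split; [lra|]. intros z Hz. destruct (Cmod_disc z Hz) as [Z0 Z1].
assert (Wz : 0 < w (Cmod z)) by (apply Hp; lra).
assert (Cs : Cmod (RtoC (1 - d) * z)%C = (1 - d) * Cmod z) by (apply Cmod_scale; lra).
unfold fsub, dilate.
destruct (Rle_dec (Cmod z) s) as [L|L].
- assert (MV : Cmod (f (RtoC (1 - d) * z) - f z)%C <= Cmod (RtoC (1 - d) * z - z)%C * M').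
  { apply (mean_value_disc f (C_derive f) s); trivial.
    - intros y Hy. apply analytic_is_cderive; trivial. unfold in_disc; lra.
    - intros y Hy. apply analytic_cont_at; [apply Hder; trivial|]. unfold in_disc; lra.
    - rewrite Cs. nra. }
  replace (RtoC (1 - d) * z - z)%C with (RtoC (- d) * z)%C in MV
    by (rewrite RtoC_minus, RtoC_opp; ring).
  rewrite Cmod_mult, Cmod_R, Rabs_Ropp, Rabs_pos_eq in MV by lra.
  assert (w (Cmod z) <= w 0) by (apply Hm; lra).
  apply Rle_trans with (d * M' * w (Cmod z)).
  + apply Rmult_le_compat_r; [lra|]. eapply Rle_trans; [exact MV|].
    rewrite Rmult_assoc, (Rmult_comm (Cmod z)), <- Rmult_assoc.
    assert (0 <= d * M') by (apply Rmult_le_pos; lra). nra.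
  + eapply Rle_trans; [|exact Hd2]. rewrite Rmult_assoc.
    apply Rmult_le_compat_l; [lra|]. apply Rmult_le_compat_l; lra.
- assert (A1 : Cmod (f z) * w (Cmod z) < eps / 2) by (apply H1; lra).
  assert (A2 : Cmod (f (RtoC (1 - d) * z)%C) * w (Cmod z) <= eps / 2).
  { assert (P := Cmod_ge_0 (f (RtoC (1 - d) * z)%C)).
    destruct (Rle_dec (Cmod (RtoC (1 - d) * z)%C) r1) as [L1|L1].
    - specialize (B _ L1). specialize (H2 (Cmod z) ltac:(lra)).
      apply (Rmult_lt_compat_l (M + 1)) in H2; [|lra].
      replace ((M + 1) * (eps / (2 * (M + 1)))) with (eps / 2) in H2 by (field; lra). nra.
    - apply Rle_trans with (Cmod (f (RtoC (1 - d) * z)%C) * w (Cmod (RtoC (1 - d) * z)%C)).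
      + apply Rmult_le_compat_l; trivial. rewrite Cs. apply Hm; nra.
      + apply Rlt_le, H1. rewrite Cs in *. nra. }
  assert (T := Cmod_triangle (f (RtoC (1 - d) * z)%C) (- f z)%C). rewrite Cmod_opp in T.
  unfold Cminus. nra.
Qed.

(** [T f] is approximated by the images of dilations of [f], which lie in the closed space
    [Hzero b]; boundedness of [T] carries the convergence over. *)
Lemma bounded_on_Hzero (T : (C -> C) -> C -> C) (a b : R -> R) :
  vanishing a -> vanishing b -> derivatives_analytic -> bounded_on T a b ->
  (forall f, analytic f -> analytic (T f)) ->
  (forall f g, analytic f -> analytic g -> eq_on_disc (T (fsub f g)) (fsub (T f) (T g))) ->
  (forall f r, analytic f -> 0 < r < 1 -> carrier (Hzero b) (T (dilate r f))) ->
  forall f, carrier (Hzero a) f -> carrier (Hzero b) (T f).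
Proof.
intros Ha Hb Hder [K [HK HT]] Tan Tsub Tdil f Hf. assert (Af := proj1 Hf).
apply Hzero_closed; auto. intros eps He.
destruct (dilate_approx a f (eps / K) Ha Hder Hf) as [r [Hr B]]; [apply Rdiv_lt_0_compat; lra|].
exists (T (dilate r f)). split; [apply Tdil; trivial|].
assert (Ad : analytic (dilate r f)) by (apply analytic_dilate; trivial; lra).
apply (bdd_ext _ (T (fsub (dilate r f) f))); [apply Tsub; trivial|].
replace eps with (K * (eps / K)) by (field; lra). apply HT; trivial.
apply analytic_fsub; trivial.
Qed.

Lemma integral_to_fsub (h k : C -> C) :
  analytic h -> analytic k ->
  eq_on_disc (integral_to (fsub h k)) (fsub (integral_to h) (integral_to k)).
Proof.
intros Hh Hk z Hz. assert (Hs := analytic_fscal (RtoC (-1)) k Hk).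
transitivity (integral_to (fadd h (fscal (RtoC (-1)) k)) z).
{ apply integral_to_ext; trivial. intros y _. symmetry. apply fsub_fadd. }
rewrite integral_to_fadd by trivial. rewrite <- fsub_fadd. unfold fadd. apply f_equal.
apply integral_to_fscal; trivial.
Qed.

Lemma Dop_Hzero (v w : R -> R) :
  vanishing v -> vanishing w -> bounded_on Dop v w -> derivatives_analytic ->
  forall f, carrier (Hzero v) f -> carrier (Hzero w) (Dop f).
Proof.
intros Hv Hw HD Hder. apply bounded_on_Hzero; trivial.
- intros; apply C_derive_fsub; trivial.
- intros f r Hf Hr.
  assert (Ad : analytic (dilate r f)) by (apply analytic_dilate; trivial; lra).
  destruct (dilate_bounded r (C_derive f)) as [M [HM B]]; [auto | lra |].
  apply (bounded_Hzero _ _ M); trivial; [apply Hder; trivial|]. intros z Hz.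
  unfold Dop. rewrite (is_C_derive_unique _ _ _ (is_cderive_dilate r f z ltac:(lra) Hf Hz)).
  rewrite Cmod_scale by lra. specialize (B z Hz). unfold dilate in B.
  assert (P := Cmod_ge_0 (C_derive f (RtoC r * z)%C)). nra.
Qed.

Lemma Jop_Hzero (v w : R -> R) :
  vanishing v -> vanishing w -> bounded_on Jop w v -> derivatives_analytic ->
  (forall f, analytic f -> analytic (Jop f)) ->
  forall f, carrier (Hzero w) f -> carrier (Hzero v) (Jop f).
Proof.
intros Hv Hw HJ Hder Jan. apply bounded_on_Hzero; trivial.
- apply integral_to_fsub.
- intros f r Hf Hr.
  assert (Ad : analytic (dilate r f)) by (apply analytic_dilate; trivial; lra).
  destruct (dilate_bounded r f) as [M [HM B]]; [auto | lra |].
  apply (bounded_Hzero _ _ M); auto. intros z Hz.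
  unfold Jop. rewrite integral_to_radial_mean, Cmod_mult by trivial.
  unfold in_disc in Hz.
  assert (A : Cmod (radial_mean (dilate r f) z) <= M).
  { apply radial_mean_le; trivial. intros y Hy. apply B. unfold in_disc; lra. }
  generalize (Cmod_ge_0 z) (Cmod_ge_0 (radial_mean (dilate r f) z)). nra.
Qed.

(** * The Volterra and Cesaro operators *)

(** The derivative of [g_sym t] on the disc. For [t = 0] it is the constant 1, so the two cases of
    [g_sym] merge once the derivative is taken. *)
Definition kern (t : R) (z : C) : C := (/ (RtoC 1 - RtoC t * z))%C.

Lemma inv_one_sub_mul_0 (t : C) : (/ (RtoC 1 - t * RtoC 0))%C = RtoC 1.
Proof.
replace (RtoC 1 - t * RtoC 0)%C with (RtoC 1) by ring.
rewrite <- (Cmult_1_l (/ RtoC 1)%C). apply Cinv_r, C1_nz.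
Qed.

Lemma kern_denom_bounds (t : R) (z : C) :
  0 <= t < 1 -> in_disc z -> 1 - t <= Cmod (RtoC 1 - RtoC t * z)%C <= 2.
Proof.
intros Ht Hz. destruct (Cmod_disc z Hz).
assert (E : Cmod (RtoC t * z)%C = t * Cmod z) by (apply Cmod_scale; lra). split.
- assert (T := Cmod_triangle (RtoC 1 - RtoC t * z)%C (RtoC t * z)%C).
  replace (RtoC 1 - RtoC t * z + RtoC t * z)%C with (RtoC 1) in T by ring.
  rewrite E, Cmod_1 in T. nra.
- eapply Rle_trans; [apply Cmod_triangle|]. rewrite Cmod_opp, E, Cmod_1. nra.
Qed.

Lemma kern_denom_neq_0 (t : R) (z : C) :
  0 <= t < 1 -> in_disc z -> (RtoC 1 - RtoC t * z)%C <> RtoC 0.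
Proof.
intros Ht Hz. apply Cmod_gt_0. destruct (kern_denom_bounds t z Ht Hz). lra.
Qed.

Lemma kern_le (t : R) (z : C) : 0 <= t < 1 -> in_disc z -> Cmod (kern t z) <= / (1 - t).
Proof.
intros Ht Hz. unfold kern. rewrite Cmod_inv by (apply kern_denom_neq_0; trivial).
apply Rinv_le_contravar; [lra|]. apply kern_denom_bounds; trivial.
Qed.

Lemma analytic_kern_denom (t : R) : analytic (fun z => RtoC 1 - RtoC t * z)%C.
Proof.
apply (analytic_fsub (fun _ => RtoC 1) (fun z => RtoC t * z)%C); [apply analytic_const|].
apply (analytic_fscal (RtoC t) (fun z => z)), analytic_id.
Qed.

Lemma analytic_kern (t : R) : 0 <= t < 1 -> analytic (kern t).
Proof.
intros Ht z Hz. eexists.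
apply (is_cderive_comp Cinv (fun z => RtoC 1 - RtoC t * z)%C).
- apply is_cderive_inv, kern_denom_neq_0; trivial.
- apply analytic_is_cderive; trivial. apply analytic_kern_denom.
Qed.

Definition kmul (t : R) (f : C -> C) : C -> C := fun z => (f z * kern t z)%C.

Lemma analytic_kmul (t : R) (f : C -> C) : 0 <= t < 1 -> analytic f -> analytic (kmul t f).
Proof. intros Ht Hf. apply analytic_mult; trivial. apply analytic_kern; trivial. Qed.

Lemma kmul_cancel (t : R) (f : C -> C) :
  0 <= t < 1 -> eq_on_disc (fun z => kmul t f z * (RtoC 1 - RtoC t * z))%C f.
Proof.
intros Ht z Hz. unfold kmul, kern. field. apply kern_denom_neq_0; trivial.
Qed.

(* Along the radius, [CLog (1 - t s z)] stays in the right half-plane, where both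
   of its real components are given by smooth formulas. *)
Lemma CLog_integral (t : R) (z : C) :
  0 <= t < 1 -> in_disc z ->
  CLog (RtoC 1 - RtoC t * z)%C = (- RtoC t * integral_to (kern t) z)%C.
Proof.
intros Ht Hz.
assert (HI := is_RInt_Cmult _ 0 1 (- RtoC t)%C _
  (is_RInt_integral_to (kern t) z (analytic_kern t Ht) Hz)).
rewrite <- integral_to_radial_mean in HI by (trivial; apply analytic_kern; trivial).
assert (G : is_RInt (V := C_R_NormedModule)
  (fun s : R => - RtoC t * (z * kern t (RtoC s * z)))%C 0 1 (CLog (RtoC 1 - RtoC t * z)%C)).
2:{ rewrite <- (is_RInt_unique (V := C_R_CompleteNormedModule) _ _ _ _ G).
    apply (is_RInt_unique (V := C_R_CompleteNormedModule)); exact HI. }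
destruct z as [x y].
assert (Hx : Rabs x < 1).
{ eapply Rle_lt_trans; [|exact Hz]. eapply Rle_trans; [|apply Rmax_Cmod]. apply Rmax_l. }
apply Rabs_def2 in Hx.
assert (Hp : forall s, 0 <= s <= 1 -> 0 < 1 - t * (s * x)).
{ intros s Hs. assert (t * (s * x) <= t); [|lra].
  rewrite <- (Rmult_1_r t) at 2. apply Rmult_le_compat_l; nra. }
(* The squared modulus of [1 - t s z]: half its logarithm is the real part of the complex logarithm,
   and the arctangent of a quotient is the imaginary part. *)
set (n := fun s => (1 - t * (s * x)) * (1 - t * (s * x)) + (t * (s * y)) * (t * (s * y))).
assert (Hn : forall s, 0 <= s <= 1 -> 0 < n s).
{ intros s Hs. unfold n. specialize (Hp s Hs). nra. }
assert (I1 : is_RInt (fun s => - t * (x * (1 - t * (s * x)) - y * (t * (s * y))) / n s) 0 1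
  (ln (sqrt (n 1)) - ln (sqrt (n 0)))).
{ apply (is_RInt_derive (V := R_CompleteNormedModule) (fun s => ln (sqrt (n s))));
    rewrite Rmin_left, Rmax_right by lra; intros s Hs; specialize (Hn s Hs).
  - unfold n in *. auto_derive.
    + repeat split; trivial. apply sqrt_lt_R0; trivial.
    + assert (Sq := sqrt_lt_R0 _ Hn).
      match goal with |- context [sqrt ?a] =>
        replace a with ((1 - t * (s * x)) * (1 - t * (s * x)) + t * (s * y) * (t * (s * y))) by ring end.
      set (q := sqrt _) in *.
      assert (Eq : q * q = (1 - t * (s * x)) * (1 - t * (s * x)) + t * (s * y) * (t * (s * y)))
        by (apply sqrt_sqrt; lra).
      rewrite <- Eq. field. lra.
  - unfold n in *. apply (ex_derive_continuous (V := R_NormedModule)). auto_derive. lra. }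
assert (I2 : is_RInt (fun s => - t * (y * (1 - t * (s * x)) + x * (t * (s * y))) / n s) 0 1
  (atan (- (t * (1 * y)) / (1 - t * (1 * x))) - atan (- (t * (0 * y)) / (1 - t * (0 * x))))).
{ apply (is_RInt_derive (V := R_CompleteNormedModule)
    (fun s => atan (- (t * (s * y)) / (1 - t * (s * x)))));
    rewrite Rmin_left, Rmax_right by lra; intros s Hs; specialize (Hn s Hs); specialize (Hp s Hs).
  - unfold n in *. auto_derive; [lra|]. field. split; [lra|].
    intros E. apply (Rlt_irrefl 0). rewrite <- E at 2. nra.
  - unfold n in *. apply (ex_derive_continuous (V := R_NormedModule)). auto_derive. lra. }
replace (ln (sqrt (n 1)) - ln (sqrt (n 0))) with (ln (sqrt (n 1))) in I1.
2:{ replace (n 0) with 1 by (unfold n; ring). rewrite sqrt_1, ln_1. ring. }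
replace (atan (- (t * (0 * y)) / (1 - t * (0 * x)))) with 0 in I2.
2:{ replace (- (t * (0 * y)) / (1 - t * (0 * x))) with 0 by (field; lra). now rewrite atan_0. }
rewrite Rminus_0_r in I2.
assert (E : (RtoC 1 - RtoC t * (x, y))%C = (1 - t * (1 * x), - (t * (1 * y)))).
{ unfold RtoC, Cminus, Cplus, Copp, Cmult. simpl. f_equal; ring. }
rewrite E. unfold CLog, CArg. unfold Re, Im, Cmod, fst, snd.
destruct (Rlt_dec 0 (1 - t * (1 * x))) as [_|N]; [|elim N; apply Hp; lra].
replace ((1 - t * (1 * x)) ^ 2 + (- (t * (1 * y))) ^ 2) with (n 1) by (unfold n; ring).
assert (Eint : forall s, 0 <= s <= 1 -> (- RtoC t * ((x, y) * kern t (RtoC s * (x, y))))%C =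
  (- t * (x * (1 - t * (s * x)) - y * (t * (s * y))) / n s,
   - t * (y * (1 - t * (s * x)) + x * (t * (s * y))) / n s)).
{ intros s Hs. specialize (Hn s Hs).
  unfold kern. replace (RtoC 1 - RtoC t * (RtoC s * (x, y)))%C with (1 - t * (s * x), - (t * (s * y)))
    by (unfold RtoC, Cminus, Cplus, Copp, Cmult; simpl; f_equal; ring).
  unfold Cinv. unfold fst at 1 2 3, snd at 1 2 3.
  replace ((1 - t * (s * x)) ^ 2 + (- (t * (s * y))) ^ 2) with (n s) by (unfold n; ring).
  unfold RtoC, Copp, Cmult; simpl. f_equal; field; lra. }
apply (is_RInt_ext (V := C_R_NormedModule) (fun s =>
  (- t * (x * (1 - t * (s * x)) - y * (t * (s * y))) / n s,
   - t * (y * (1 - t * (s * x)) + x * (t * (s * y))) / n s) : C)).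
- rewrite Rmin_left, Rmax_right by lra. intros s Hs. symmetry. apply Eint. lra.
- apply (is_RInt_fct_extend_pair (U := R_NormedModule) (V := R_NormedModule)); trivial.
Qed.

(** Everything that the argument draws from the continuity of [Dop] and [Jop]; [admissible_intro]
    derives it from the hypotheses. *)
Definition admissible (v w : R -> R) : Prop :=
  vanishing v /\ vanishing w /\ bounded_on Dop v w /\ bounded_on Jop w v /\
  derivatives_analytic /\ (forall f, analytic f -> analytic (Jop f)).

Lemma C_derive_Jop (v w : R -> R) (k : C -> C) :
  admissible v w -> analytic k -> eq_on_disc (C_derive (Jop k)) k.
Proof.
intros (_ & _ & _ & _ & Hder & HJ) Hk. apply C_derive_integral_to; trivial; [apply HJ | apply Hder, HJ]; trivial.
Qed.

Lemma C_derive_g_sym (v w : R -> R) (t : R) :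
  admissible v w -> 0 <= t < 1 -> eq_on_disc (C_derive (g_sym t)) (kern t).
Proof.
intros Ha Ht z Hz. assert (Hk := analytic_kern t Ht). unfold g_sym.
destruct (Req_EM_T t 0) as [E|E].
- subst t. transitivity (RtoC 1).
  + apply is_C_derive_unique. apply is_cderive_id.
  + rewrite <- (inv_one_sub_mul_0 z). unfold kern. f_equal. ring.
(* [CLog_integral] identifies the logarithm with an integral, so its derivative is that of
   [Jop (kern t)] and [CLog] itself is not differentiated. *)
- transitivity (C_derive (Jop (kern t)) z); [|apply (C_derive_Jop v w); trivial].
  apply C_derive_ext; trivial; [apply Ha; trivial|].
  intros y Hy. rewrite CLog_integral by trivial. unfold Jop. field.
  intros E'; apply RtoC_inj in E'; lra.
Qed.

Lemma Volterra_op_Jop (v w : R -> R) (t : R) (f : C -> C) :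
  admissible v w -> 0 <= t < 1 -> eq_on_disc (Volterra_op (g_sym t) f) (Jop (kmul t f)).
Proof.
intros Ha Ht z Hz. apply integral_to_ext; trivial. intros y Hy.
unfold kmul. now rewrite (C_derive_g_sym v w).
Qed.

Lemma Cesaro_op_radial_mean (t : R) (f : C -> C) :
  0 <= t < 1 -> analytic f -> eq_on_disc (Cesaro_op t f) (radial_mean (kmul t f)).
Proof.
intros Ht Hf z Hz. assert (Hk := analytic_kmul t f Ht Hf).
unfold Cesaro_op. destruct (Ceq_dec z (RtoC 0)) as [->|Hz0].
- symmetry. unfold radial_mean. apply (is_RInt_unique (V := C_R_CompleteNormedModule)).
  assert (H := is_RInt_const (V := C_R_NormedModule) 0 1 (f (RtoC 0))).
  assert (Es : @scal R_Ring C_R_ModuleSpace (1 - 0) (f (RtoC 0)) = f (RtoC 0)).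
  { rewrite scal_R_Cmult, Rminus_0_r. apply Cmult_1_l. }
  apply (eq_ind _ (is_RInt (V := C_R_NormedModule) (fun _ => f (RtoC 0)) 0 1) H) in Es.
  eapply is_RInt_ext; [|exact Es]. intros s _. unfold kmul, kern.
  rewrite Cmult_0_r, inv_one_sub_mul_0. symmetry. apply Cmult_1_r.
- change (/ z * integral_to (kmul t f) z = radial_mean (kmul t f) z)%C.
  rewrite integral_to_radial_mean by trivial. field. trivial.
Qed.

(** Off the origin the mean is [integral_to k] divided by the variable. At the origin the expansion
    [k(0) + s y k'(0) + o(s y)] of [k (s y)] is averaged over [s], and the mean of [s] is [1 / 2],
    so the derivative is half of [k'(0)]. *)
Lemma analytic_radial_mean (k : C -> C) :
  analytic k -> analytic (integral_to k) -> analytic (radial_mean k).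
Proof.
intros Hk HJ z Hz. destruct (Ceq_dec z (RtoC 0)) as [->|Hz0].
- exists (C_derive k (RtoC 0) / RtoC 2)%C. apply is_cderive_eps. intros eps He.
  set (D := C_derive k (RtoC 0)).
  assert (Hd := analytic_is_cderive k _ Hk in_disc_0). rewrite is_cderive_eps in Hd.
  destruct (Hd eps He) as [d [Hd0 H]]. fold D in H.
  exists (Rmin d 1). split; [apply Rmin_pos; lra|]. intros y Hy.
  apply Rmin_Rgt in Hy as [Hy1 Hy2].
  replace (y - RtoC 0)%C with y in * by ring.
  (* The integral of [2 s] over [[0, 1]], obtained from the primitive [x * x] along the segment from
     0 to 1. *)
  assert (Isq : is_RInt (V := C_R_NormedModule)
    (fun u => RtoC 1 * (RtoC 2 * (RtoC 0 + RtoC u * RtoC 1)))%C 0 1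
    ((RtoC 0 + RtoC 1) * (RtoC 0 + RtoC 1) - RtoC 0 * RtoC 0)%C).
  { apply (is_RInt_derive_path (fun x => x * x)%C (fun x => RtoC 2 * x)%C).
    - intros s _. set (x := (RtoC 0 + RtoC s * RtoC 1)%C).
      assert (D2 := is_cderive_mult (fun x => x) (fun x => x) x _ _ (is_cderive_id x) (is_cderive_id x)).
      cbv beta in D2. now replace (RtoC 1 * x + x * RtoC 1)%C with (RtoC 2 * x)%C in D2 by ring.
    - intros s _. eapply is_cderive_cont_at.
      apply (is_cderive_mult (fun _ => RtoC 2) (fun x => x)); [apply is_cderive_const | apply is_cderive_id]. }
  assert (I0 := is_RInt_radial_mean k _ Hk in_disc_0).
  assert (Iy := is_RInt_radial_mean k y Hk Hy2).
  assert (I := is_RInt_minus (V := C_R_NormedModule) _ _ _ _ _ _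
    (is_RInt_minus (V := C_R_NormedModule) _ _ _ _ _ _ Iy I0)
    (is_RInt_Cmult _ _ _ (y * D / RtoC 2)%C _ Isq)).
  apply Cmod_RInt_le with (f := fun s => (k (RtoC s * y) - k (RtoC s * RtoC 0)
    - (y * D / RtoC 2) * (RtoC 1 * (RtoC 2 * (RtoC 0 + RtoC s * RtoC 1))))%C).
  + intros s Hs.
    replace ((y * D / RtoC 2) * (RtoC 1 * (RtoC 2 * (RtoC 0 + RtoC s * RtoC 1))))%C
      with (RtoC s * y * D)%C by (field; intros E; apply RtoC_inj in E; lra).
    rewrite Cmult_0_r. specialize (H (RtoC s * y)%C).
    replace (RtoC s * y - RtoC 0)%C with (RtoC s * y)%C in H by ring.
    rewrite Cmod_scale in H by lra. assert (P := Cmod_ge_0 y).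
    eapply Rle_trans; [apply H; nra|]. apply Rmult_le_compat_l; nra.
  + replace (radial_mean k y - radial_mean k (RtoC 0) - y * (D / RtoC 2))%C with
      (radial_mean k y - radial_mean k (RtoC 0) - (y * D / RtoC 2)
        * ((RtoC 0 + RtoC 1) * (RtoC 0 + RtoC 1) - RtoC 0 * RtoC 0))%C.
    * exact I.
    * field.
- eexists. eapply (is_derive_ext_loc (K := C_AbsRing) (V := C_NormedModule)
    (fun x => / x * integral_to k x)%C).
  + destruct (Cmod_disc z Hz) as [Z0 Z1]. assert (Zp : 0 < Cmod z) by (apply Cmod_gt_0; trivial).
    assert (Hm : 0 < Rmin (Cmod z) (1 - Cmod z)) by (apply Rmin_pos; lra).
    exists (mkposreal _ Hm). intros x Hx. change (Cmod (x - z)%C < Rmin (Cmod z) (1 - Cmod z)) in Hx.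
    apply Rmin_Rgt in Hx as [Hx1 Hx2].
    assert (Hxd : in_disc x).
    { unfold in_disc. replace x with ((x - z) + z)%C by ring.
      eapply Rle_lt_trans; [apply Cmod_triangle|]. lra. }
    assert (Hx0 : x <> RtoC 0).
    { intros ->. replace (RtoC 0 - z)%C with (- z)%C in Hx1 by ring. rewrite Cmod_opp in Hx1. lra. }
    rewrite integral_to_radial_mean by trivial.
    now rewrite Cmult_assoc, Cinv_l, Cmult_1_l.
  + apply is_cderive_mult; [apply is_cderive_inv; trivial | apply analytic_is_cderive; trivial].
Qed.

(** * Estimates and memberships for the two operators *)

Lemma bdd_mult (w : R -> R) (f m : C -> C) (M B : R) :
  vanishing w -> (forall z, in_disc z -> Cmod (m z) <= B) -> bdd w f M ->
  bdd w (fun z => f z * m z)%C (B * M).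
Proof.
intros [Hp _] Hm Hf z Hz. specialize (Hm z Hz). specialize (Hf z Hz).
assert (W : 0 < w (Cmod z)) by (apply Hp, Cmod_disc, Hz).
rewrite Cmod_mult, (Rmult_comm (Cmod (f z))), Rmult_assoc.
apply Rmult_le_compat; trivial; [apply Cmod_ge_0|].
apply Rmult_le_pos; [apply Cmod_ge_0 | lra].
Qed.

Lemma Hzero_mult (w : R -> R) (f m : C -> C) (B : R) :
  vanishing w -> analytic m -> (forall z, in_disc z -> Cmod (m z) <= B) ->
  carrier (Hzero w) f -> carrier (Hzero w) (fun z => f z * m z)%C.
Proof.
intros [Hp _] Am Hm [Hf H]. split; [apply analytic_mult; trivial|].
assert (HB : 0 <= B) by (eapply Rle_trans; [apply Cmod_ge_0 | apply (Hm _ in_disc_0)]).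
intros eps He. destruct (H (eps / (B + 1))) as [r [Hr Hr']]; [apply Rdiv_lt_0_compat; lra|].
exists r; split; trivial. intros z Hz. specialize (Hr' z Hz). specialize (Hm z (proj2 Hz)).
assert (W : 0 < w (Cmod z)) by (apply Hp, Cmod_disc, Hz).
apply (Rmult_lt_compat_l (B + 1)) in Hr'; [|lra].
replace ((B + 1) * (eps / (B + 1))) with eps in Hr' by (field; lra).
rewrite Cmod_mult, (Rmult_comm (Cmod (f z))), Rmult_assoc.
assert (P : 0 <= Cmod (f z) * w (Cmod z)) by (apply Rmult_le_pos; [apply Cmod_ge_0 | lra]).
assert (Cmod (m z) * (Cmod (f z) * w (Cmod z)) <= B * (Cmod (f z) * w (Cmod z)))
  by (apply Rmult_le_compat_r; trivial). lra.
Qed.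

Lemma Hzero_ext (w : R -> R) (f g : C -> C) :
  eq_on_disc f g -> carrier (Hzero w) f -> carrier (Hzero w) g.
Proof.
intros E [Hf H]. split; [apply (analytic_ext f); trivial|].
intros eps He. destruct (H eps He) as [r [Hr H']]. exists r; split; trivial.
intros z Hz. rewrite <- E by apply Hz. auto.
Qed.

Lemma Jop_kmul_bounded_on (v w : R -> R) (t : R) :
  admissible v w -> 0 <= t < 1 -> bounded_on (fun f => Jop (kmul t f)) w v.
Proof.
intros (Hv & Hw & _ & [K [HK HJ]] & _) Ht.
assert (P : 0 < / (1 - t)) by (apply Rinv_0_lt_compat; lra).
exists (K * / (1 - t)). split; [apply Rmult_lt_0_compat; trivial|].
intros f M Hf B. rewrite Rmult_assoc. apply HJ; [apply analytic_kmul; trivial|].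
apply bdd_mult; trivial. intros z Hz. apply kern_le; trivial.
Qed.

Lemma kmul_bdd_Jop (v w : R -> R) (t : R) :
  admissible v w -> 0 <= t < 1 ->
  exists K, 0 < K /\ forall f M, analytic f -> bdd v (Jop (kmul t f)) M -> bdd w (kmul t f) (K * M).
Proof.
intros Ha Ht. assert (Ha' := Ha). destruct Ha' as (Hv & Hw & [K [HK HD]] & _ & Hder & HJ).
exists K. split; trivial. intros f M Hf B.
assert (Hk := analytic_kmul t f Ht Hf).
apply (bdd_ext _ (Dop (Jop (kmul t f)))); [apply (C_derive_Jop v w); trivial|].
apply HD; auto.
Qed.

Lemma bdd_kmul (w : R -> R) (t : R) (f : C -> C) (M : R) :
  vanishing w -> 0 <= t < 1 -> bdd w (kmul t f) M -> bdd w f (2 * M).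
Proof.
intros Hw Ht B. apply (bdd_ext _ _ _ _ (kmul_cancel t f Ht)). apply bdd_mult; trivial.
intros z Hz. apply kern_denom_bounds; trivial.
Qed.

Lemma Hzero_Jop_kmul (v w : R -> R) (t : R) (f : C -> C) :
  admissible v w -> 0 <= t < 1 -> analytic f ->
  carrier (Hzero v) (Jop (kmul t f)) <-> carrier (Hzero w) f.
Proof.
intros Ha Ht Hf. assert (Ha' := Ha). destruct Ha' as (Hv & Hw & HD & HJ & Hder & Jan).
assert (Hk := analytic_kmul t f Ht Hf). split; intros H.
- apply (Hzero_ext _ _ _ (kmul_cancel t f Ht)).
  apply (Hzero_mult _ _ _ 2); trivial.
  + apply analytic_kern_denom.
  + intros z Hz. apply kern_denom_bounds; trivial.
  + apply (Hzero_ext _ (Dop (Jop (kmul t f)))); [apply (C_derive_Jop v w); trivial|].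
    apply (Dop_Hzero v w); trivial.
- apply (Jop_Hzero v w); trivial. apply (Hzero_mult _ _ _ (/ (1 - t))); trivial.
  + apply analytic_kern; trivial.
  + intros z Hz. apply kern_le; trivial.
Qed.

Lemma bdd_Jop_radial_mean (v : R -> R) (k : C -> C) (M : R) :
  vanishing v -> analytic k -> bdd v (radial_mean k) M -> bdd v (Jop k) M.
Proof.
intros [Hp _] Hk B z Hz. specialize (B z Hz). unfold Jop.
rewrite integral_to_radial_mean, Cmod_mult by trivial.
assert (W : 0 < v (Cmod z)) by (apply Hp, Cmod_disc, Hz). destruct (Cmod_disc z Hz).
assert (P : 0 <= Cmod (radial_mean k z) * v (Cmod z)) by (apply Rmult_le_pos; [apply Cmod_ge_0 | lra]).
rewrite Rmult_assoc. nra.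
Qed.

Lemma radial_mean_le_Jop (k : C -> C) (z : C) :
  analytic k -> in_disc z -> 1 / 2 < Cmod z -> Cmod (radial_mean k z) <= 2 * Cmod (Jop k z).
Proof.
intros Hk Hz Hz2. unfold Jop. rewrite integral_to_radial_mean, Cmod_mult by trivial.
assert (P := Cmod_ge_0 (radial_mean k z)). nra.
Qed.

(* Division by [z] is harmless for [1/2 < Cmod z]; on the rest of the disc the mean
   is controlled by the supremum of [k = (Jop k)']. *)
Lemma bdd_radial_mean_Jop (v w : R -> R) (t : R) :
  admissible v w -> 0 <= t < 1 ->
  exists K, 0 < K /\ forall f M, analytic f -> bdd v (Jop (kmul t f)) M ->
    bdd v (radial_mean (kmul t f)) (K * M).
Proof.
intros Ha Ht. destruct (kmul_bdd_Jop v w t Ha Ht) as [K [HK HD]].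
destruct Ha as (Hv & Hw & _ & _ & _ & _).
assert (V0 : 0 < v 0) by (apply (proj1 Hv); lra).
assert (W : 0 < w (1 / 2)) by (apply (proj1 Hw); lra).
assert (Q : 0 < v 0 * K / w (1 / 2)) by (apply Rdiv_lt_0_compat; [apply Rmult_lt_0_compat|]; lra).
exists (2 + v 0 * K / w (1 / 2)). split; [lra|].
intros f M Hf B z Hz. assert (HM := bdd_ge_0 _ _ _ Hv B). assert (Hk := analytic_kmul t f Ht Hf).
specialize (HD f M Hf B). destruct (Cmod_disc z Hz) as [Z0 Z1].
assert (Vz : 0 < v (Cmod z)) by (apply (proj1 Hv); lra).
assert (QM : 0 <= v 0 * K / w (1 / 2) * M) by (apply Rmult_le_pos; lra).
destruct (Rlt_dec (1 / 2) (Cmod z)) as [L|L].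
- assert (R1 := radial_mean_le_Jop _ z Hk Hz L). specialize (B z Hz). nra.
- assert (R1 : Cmod (radial_mean (kmul t f) z) <= K * M / w (1 / 2)).
  { apply radial_mean_le; trivial. intros y Hy.
    specialize (HD y ltac:(unfold in_disc; lra)).
    assert (w (1 / 2) <= w (Cmod y)) by (apply (proj2 Hw); [apply Cmod_ge_0 | lra | lra]).
    apply (Rmult_le_reg_r (w (1 / 2))); trivial.
    unfold Rdiv at 2. rewrite Rmult_assoc, Rinv_l, Rmult_1_r by lra.
    assert (P := Cmod_ge_0 (kmul t f y)). nra. }
  assert (V1 : v (Cmod z) <= v 0) by (apply (proj2 Hv); lra).
  apply Rle_trans with (K * M / w (1 / 2) * v 0).
  + apply Rmult_le_compat; trivial; [apply Cmod_ge_0 | lra].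
  + replace (K * M / w (1 / 2) * v 0) with (v 0 * K / w (1 / 2) * M) by (field; lra). nra.
Qed.

Lemma Hzero_radial_mean (v : R -> R) (k : C -> C) :
  vanishing v -> analytic k -> analytic (integral_to k) ->
  carrier (Hzero v) (radial_mean k) <-> carrier (Hzero v) (Jop k).
Proof.
intros Hv Hk HJ. split; intros H.
- apply (Hzero_ext _ (fun z => radial_mean k z * z)%C).
  + intros z Hz. unfold Jop. rewrite integral_to_radial_mean by trivial. apply Cmult_comm.
  + apply (Hzero_mult _ _ _ 1); trivial; [apply analytic_id|]. intros z Hz. apply Rlt_le, Hz.
- split; [apply analytic_radial_mean; trivial|]. destruct H as [_ H].
  intros eps He. destruct (H (eps / 2)) as [r [Hr H']]; [lra|].
  exists (Rmax r (1 / 2)). split; [apply Rmax_lub_lt; lra|]. intros z Hz.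
  generalize (Rmax_l r (1 / 2)) (Rmax_r r (1 / 2)). intros.
  specialize (H' z ltac:(lra)).
  assert (R1 := radial_mean_le_Jop k z Hk (proj2 Hz) ltac:(lra)).
  assert (Vz : 0 < v (Cmod z)) by (apply (proj1 Hv), Cmod_disc, Hz). nra.
Qed.

(** The two estimates squeeze the norm of the optimal domain between multiples of the norm of [Y],
    so definiteness and completeness come from [Y]. Keeping [X] and [Y] abstract serves both
    operators and both the big-O and the little-o spaces. *)
Lemma optimal_domain_iso (T : (C -> C) -> C -> C) (v w : R -> R) (X Y : normed_space) (K : R) :
  vanishing v -> is_banach Y ->
  (forall f, carrier X f -> carrier (Hinf v) f) -> nrm X = weighted_norm v ->
  (forall f, carrier Y f -> carrier (Hinf w) f) -> nrm Y = weighted_norm w ->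
  (forall f, analytic f -> carrier X (T f) <-> carrier Y f) ->
  (forall f g, analytic f -> analytic g -> eq_on_disc (T (fadd f g)) (fadd (T f) (T g))) ->
  (forall c f, analytic f -> eq_on_disc (T (fscal c f)) (fscal c (T f))) ->
  bounded_on T w v ->
  0 < K -> (forall f M, analytic f -> bdd v (T f) M -> bdd w f (K * M)) ->
  is_banach (optimal_domain T X) /\ same_carrier (optimal_domain T X) Y /\
  equivalent_norms (optimal_domain T X) Y.
Proof.
intros Hv (Ylin & Ynorm & Ycomp) HX NX HY NY Hcar Tadd Tscal [L [HL HT]] HK HTinv.
assert (Yan := proj1 Ylin).
assert (Car : same_carrier (optimal_domain T X) Y).
{ intros f. split.
  - intros [Hf H]. apply Hcar; trivial.
  - intros H. split; [auto|]. apply Hcar; auto. }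
assert (Le1 : forall f, carrier Y f -> nrm Y f <= K * nrm (optimal_domain T X) f).
{ intros f Hf. simpl. rewrite NX, NY. apply bdd_weighted_norm, HTinv; auto.
  apply Hinf_bdd, HX, Hcar; auto. }
assert (Le2 : forall f, carrier Y f -> nrm (optimal_domain T X) f <= L * nrm Y f).
{ intros f Hf. simpl. rewrite NX, NY. apply bdd_weighted_norm, HT; auto.
  apply Hinf_bdd, HY, Hf. }
assert (HTv : forall f, carrier Y f -> carrier (Hinf v) (T f)).
{ intros f Hf. apply HX, Hcar; auto. }
destruct (Hinf_is_norm v Hv) as (V1 & _ & V3 & V4).
destruct Ynorm as (Y1 & Y2 & Y3 & Y4). destruct Ylin as (_ & Y5 & Y6 & Y7).
split; [|split; trivial].
- split; [|split].
  + split; [intros f Hf; apply Hf|]. split; [apply Car, Y5|]. split.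
    * intros f g Hf Hg. apply Car in Hf, Hg. apply Car. auto.
    * intros c f Hf. apply Car in Hf. apply Car. auto.
  + assert (P : forall f, carrier Y f -> 0 <= nrm (optimal_domain T X) f).
    { intros f Hf. simpl. rewrite NX. apply V1; auto. }
    split; [intros f Hf; apply P, Car, Hf|]. split; [|split].
    * intros f Hf. apply Car in Hf. rewrite <- Y2 by trivial.
      specialize (Le1 f Hf). specialize (Le2 f Hf). specialize (P f Hf). specialize (Y1 f Hf).
      split; intros E; rewrite E in *; lra.
    * intros c f Hf. apply Car in Hf. simpl. rewrite NX.
      rewrite (weighted_norm_ext v _ _ (Tscal c f (Yan f Hf))). apply V3; auto.
    * intros f g Hf Hg. apply Car in Hf, Hg. simpl. rewrite NX.
      rewrite (weighted_norm_ext v _ _ (Tadd f g (Yan f Hf) (Yan g Hg))). apply V4; auto.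
  + intros u Hu HC.
    assert (Hu' : forall n, carrier Y (u n)) by (intros n; apply Car, Hu).
    assert (Ysub : forall f g, carrier Y f -> carrier Y g -> carrier Y (fsub f g)).
    { intros f g Hf Hg. apply Hcar; [apply analytic_fsub; auto|].
      assert (E := Y6 _ _ Hf (Y7 (RtoC (-1)) g Hg)). apply Hcar in E; [|auto].
      replace (fsub f g) with (fadd f (fscal (RtoC (-1)) g)); trivial.
      apply functional_extensionality. intros z. apply fsub_fadd. }
    destruct (Ycomp u Hu') as [f [Hf Hlim]].
    * intros eps He. destruct (HC (eps / K)) as [N HN]; [apply Rdiv_lt_0_compat; trivial|].
      exists N. intros m n Hm Hn. specialize (HN m n Hm Hn).
      eapply Rle_lt_trans; [apply Le1; auto|].
      apply (Rmult_lt_compat_l K) in HN; trivial.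
      replace (K * (eps / K)) with eps in HN by (field; lra). exact HN.
    * exists f. split; [apply Car, Hf|]. intros eps He.
      destruct (Hlim (eps / L)) as [N HN]; [apply Rdiv_lt_0_compat; trivial|].
      exists N. intros n Hn. specialize (HN n Hn).
      eapply Rle_lt_trans; [apply Le2; auto|].
      apply (Rmult_lt_compat_l L) in HN; trivial.
      replace (L * (eps / L)) with eps in HN by (field; lra). exact HN.
- exists (/ L), K. split; [apply Rinv_0_lt_compat; trivial|]. split; trivial.
  intros f Hf. apply Car in Hf. split; [|auto].
  apply (Rmult_le_reg_l L); trivial. rewrite <- Rmult_assoc, Rinv_r, Rmult_1_l by lra. auto.
Qed.

(** Each optimal domain is compared only with the weighted space [Z]; composing the two comparisons
    gives the constants [a / d] and [b / c]. *)
Lemma banach_eq_of_common (X Y Z : normed_space) :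
  is_banach Z ->
  is_banach X /\ same_carrier X Z /\ equivalent_norms X Z ->
  is_banach Y /\ same_carrier Y Z /\ equivalent_norms Y Z ->
  banach_eq X Y /\ banach_eq Y Z.
Proof.
intros BZ (BX & CX & [a [b (Ha & Hb & HX)]]) (BY & CY & [c [d (Hc & Hd & HY)]]).
split; [|split; [|split; [|split]]]; trivial; [|exists c, d; auto].
split; [|split; [|split]]; trivial.
- intros f. rewrite (CX f), (CY f). reflexivity.
- exists (a / d), (b / c). split; [apply Rdiv_lt_0_compat; trivial|].
  split; [apply Rdiv_lt_0_compat; trivial|]. intros f Hf.
  assert (Hf' : carrier Y f) by (apply CY, CX, Hf).
  destruct (HX f Hf). destruct (HY f Hf'). split.
  + apply (Rmult_le_reg_l d); trivial.
    replace (d * (a / d * nrm X f)) with (a * nrm X f) by (field; lra). lra.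
  + apply (Rmult_le_reg_l c); trivial.
    replace (c * (b / c * nrm X f)) with (b * nrm X f) by (field; lra). lra.
Qed.

Lemma kmul_fadd (t : R) (f g : C -> C) : kmul t (fadd f g) = fadd (kmul t f) (kmul t g).
Proof. apply functional_extensionality. intros z. unfold kmul, fadd. ring. Qed.

Lemma kmul_fscal (t : R) (c : C) (f : C -> C) : kmul t (fscal c f) = fscal c (kmul t f).
Proof. apply functional_extensionality. intros z. unfold kmul, fscal. ring. Qed.

Lemma radial_mean_fadd (h k : C -> C) :
  analytic h -> analytic k ->
  eq_on_disc (radial_mean (fadd h k)) (fadd (radial_mean h) (radial_mean k)).
Proof.
intros Hh Hk z Hz. unfold radial_mean at 1.
apply (is_RInt_unique (V := C_R_CompleteNormedModule)).
apply (is_RInt_plus (V := C_R_NormedModule)); apply is_RInt_radial_mean; trivial.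
Qed.

Lemma radial_mean_fscal (c : C) (k : C -> C) :
  analytic k -> eq_on_disc (radial_mean (fscal c k)) (fscal c (radial_mean k)).
Proof.
intros Hk z Hz. unfold radial_mean at 1.
apply (is_RInt_unique (V := C_R_CompleteNormedModule)).
apply (is_RInt_Cmult (fun s => k (RtoC s * z)%C)), is_RInt_radial_mean; trivial.
Qed.

Lemma Hinf_ext (w : R -> R) (f g : C -> C) :
  eq_on_disc f g -> carrier (Hinf w) f -> carrier (Hinf w) g.
Proof.
intros E H. eapply bdd_Hinf; [apply (analytic_ext f); trivial; apply H|].
apply (bdd_ext _ f); trivial. apply Hinf_bdd, H.
Qed.

Lemma eq_on_disc_sym (f g : C -> C) : eq_on_disc f g -> eq_on_disc g f.
Proof. intros E z Hz. symmetry; auto. Qed.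

Lemma Hinf_Jop_kmul (v w : R -> R) (t : R) (f : C -> C) :
  admissible v w -> 0 <= t < 1 -> analytic f ->
  carrier (Hinf v) (Jop (kmul t f)) <-> carrier (Hinf w) f.
Proof.
intros Ha Ht Hf. assert (Ha' := Ha). destruct Ha' as (Hv & Hw & _ & _ & _ & Jan).
split; intros H.
- destruct (kmul_bdd_Jop v w t Ha Ht) as [K [HK HB]].
  eapply bdd_Hinf; trivial. eapply bdd_kmul; eauto. apply HB; trivial. apply Hinf_bdd, H.
- destruct (Jop_kmul_bounded_on v w t Ha Ht) as [K [HK HB]].
  eapply bdd_Hinf; [apply Jan, analytic_kmul; trivial|]. apply HB; trivial. apply Hinf_bdd, H.
Qed.

Lemma Hinf_radial_mean (v w : R -> R) (t : R) (f : C -> C) :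
  admissible v w -> 0 <= t < 1 -> analytic f ->
  carrier (Hinf v) (radial_mean (kmul t f)) <-> carrier (Hinf v) (Jop (kmul t f)).
Proof.
intros Ha Ht Hf. assert (Hk := analytic_kmul t f Ht Hf).
assert (Ha' := Ha). destruct Ha' as (Hv & Hw & _ & _ & _ & Jan). split; intros H.
- eapply bdd_Hinf; [apply Jan; trivial|]. apply bdd_Jop_radial_mean; trivial. apply Hinf_bdd, H.
- destruct (bdd_radial_mean_Jop v w t Ha Ht) as [K [HK HB]].
  eapply bdd_Hinf; [apply analytic_radial_mean; trivial; apply Jan; trivial|].
  apply HB; trivial. apply Hinf_bdd, H.
Qed.

Lemma optimal_domain_Volterra (v w : R -> R) (t : R) (X Y : normed_space) :
  admissible v w -> 0 <= t < 1 -> is_banach Y ->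
  (forall f, carrier X f -> carrier (Hinf v) f) -> nrm X = weighted_norm v ->
  (forall f, carrier Y f -> carrier (Hinf w) f) -> nrm Y = weighted_norm w ->
  (forall f g, eq_on_disc f g -> carrier X f -> carrier X g) ->
  (forall f, analytic f -> carrier X (Jop (kmul t f)) <-> carrier Y f) ->
  is_banach (optimal_domain (Volterra_op (g_sym t)) X) /\
  same_carrier (optimal_domain (Volterra_op (g_sym t)) X) Y /\
  equivalent_norms (optimal_domain (Volterra_op (g_sym t)) X) Y.
Proof.
intros Ha Ht BY HX NX HY NY Xext HXY.
assert (Ha' := Ha). destruct Ha' as (Hv & Hw & _ & _ & _ & Jan).
destruct (kmul_bdd_Jop v w t Ha Ht) as [K [HK HB]].
assert (E := fun f => Volterra_op_Jop v w t f Ha Ht).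
assert (E' := fun f => eq_on_disc_sym _ _ (E f)).
(* [K] comes from the bound on [Dop], and 2 bounds the factor [1 - t z] that recovers [f] from
   [kmul t f]. *)
apply (optimal_domain_iso _ v w X Y (2 * K)); trivial.
- intros f Hf. rewrite <- HXY by trivial. split; apply Xext; trivial.
- intros f g Hf Hg z Hz. rewrite E, kmul_fadd by trivial. unfold fadd at 2. rewrite !E by trivial.
  apply integral_to_fadd; trivial; apply analytic_kmul; trivial.
- intros c f Hf z Hz. rewrite E, kmul_fscal by trivial. unfold fscal at 2. rewrite E by trivial.
  apply integral_to_fscal; trivial; apply analytic_kmul; trivial.
- destruct (Jop_kmul_bounded_on v w t Ha Ht) as [L [HL HBL]]. exists L. split; trivial.
  intros f M Hf B. apply (bdd_ext _ _ _ _ (E' f)). auto.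
- lra.
- intros f M Hf B. rewrite Rmult_assoc. apply (bdd_kmul w t); trivial. apply HB; trivial.
  apply (bdd_ext _ _ _ _ (E f)). trivial.
Qed.

Lemma optimal_domain_Cesaro (v w : R -> R) (t : R) (X Y : normed_space) :
  admissible v w -> 0 <= t < 1 -> is_banach Y ->
  (forall f, carrier X f -> carrier (Hinf v) f) -> nrm X = weighted_norm v ->
  (forall f, carrier Y f -> carrier (Hinf w) f) -> nrm Y = weighted_norm w ->
  (forall f g, eq_on_disc f g -> carrier X f -> carrier X g) ->
  (forall f, analytic f -> carrier X (radial_mean (kmul t f)) <-> carrier Y f) ->
  is_banach (optimal_domain (Cesaro_op t) X) /\
  same_carrier (optimal_domain (Cesaro_op t) X) Y /\
  equivalent_norms (optimal_domain (Cesaro_op t) X) Y.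
Proof.
intros Ha Ht BY HX NX HY NY Xext HXY.
assert (Ha' := Ha). destruct Ha' as (Hv & Hw & _ & _ & _ & Jan).
destruct (kmul_bdd_Jop v w t Ha Ht) as [K [HK HB]].
destruct (bdd_radial_mean_Jop v w t Ha Ht) as [K' [HK' HB']].
assert (E := fun f => Cesaro_op_radial_mean t f Ht).
assert (E' := fun f Hf => eq_on_disc_sym _ _ (E f Hf)).
apply (optimal_domain_iso _ v w X Y (2 * K)); trivial.
- intros f Hf. rewrite <- HXY by trivial. split; apply Xext; auto.
- intros f g Hf Hg z Hz. rewrite E, kmul_fadd by (trivial; apply analytic_fadd; trivial).
  unfold fadd at 2. rewrite !E by trivial.
  apply radial_mean_fadd; trivial; apply analytic_kmul; trivial.
- intros c f Hf z Hz. rewrite E, kmul_fscal by (trivial; apply analytic_fscal; trivial).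
  unfold fscal at 2. rewrite E by trivial.
  apply radial_mean_fscal; trivial; apply analytic_kmul; trivial.
(* [L] bounds the passage from [f] to [Jop (kmul t f)], and [K'] the passage from there to the
   mean. *)
- destruct (Jop_kmul_bounded_on v w t Ha Ht) as [L [HL HBL]]. exists (K' * L).
  split; [apply Rmult_lt_0_compat; trivial|].
  intros f M Hf B. apply (bdd_ext _ _ _ _ (E' f Hf)). rewrite Rmult_assoc. auto.
- lra.
- intros f M Hf B. rewrite Rmult_assoc. apply (bdd_kmul w t); trivial. apply HB; trivial.
  apply bdd_Jop_radial_mean; trivial; [apply analytic_kmul; trivial|].
  apply (bdd_ext _ _ _ _ (E f Hf)). trivial.
Qed.

(** * A function in [Hzero w] outside [Hinf v] *)

Definition mono (n : nat) (z : C) : C := Cpow z n.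

Lemma is_cderive_mono (n : nat) (z : C) :
  is_cderive (mono (S n)) z (RtoC (INR (S n)) * mono n z)%C.
Proof.
induction n as [|n IH].
- assert (D := is_cderive_mult (fun x => x) (fun _ => RtoC 1) z _ _ (is_cderive_id z) (is_cderive_const _ z)).
  cbv beta in D. unfold mono. simpl Cpow.
  now replace (RtoC (INR 1) * RtoC 1)%C with (RtoC 1 * RtoC 1 + z * RtoC 0)%C by (simpl; ring).
- assert (D := is_cderive_mult (fun x => x) (mono (S n)) z _ _ (is_cderive_id z) IH).
  cbv beta in D.
  replace (RtoC (INR (S (S n))) * mono (S n) z)%C with
    (RtoC 1 * mono (S n) z + z * (RtoC (INR (S n)) * mono n z))%C; [exact D|].
  rewrite (S_INR (S n)), RtoC_plus. unfold mono. rewrite !Cpow_S. ring.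
Qed.

Lemma analytic_mono (n : nat) : analytic (mono n).
Proof.
destruct n; [apply (analytic_const (RtoC 1))|]. intros z _. eexists. apply is_cderive_mono.
Qed.

Lemma Cmod_mono (n : nat) (z : C) : Cmod (mono n z) = Cmod z ^ n.
Proof. apply Cmod_pow. Qed.

Lemma mono_Hzero (w : R -> R) (n : nat) : vanishing w -> carrier (Hzero w) (mono n).
Proof.
intros Hw. apply (bounded_Hzero _ _ 1); trivial; [apply analytic_mono|].
intros z Hz. rewrite Cmod_mono. rewrite <- (pow1 n). apply pow_incr.
destruct (Cmod_disc z Hz). lra.
Qed.

Lemma weighted_norm_mono_pos (w : R -> R) (n : nat) :
  vanishing w -> 0 < weighted_norm w (mono n).
Proof.
intros Hw. assert (B := Hinf_bdd _ _ (Hzero_Hinf w _ Hw (mono_Hzero w n Hw))).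
assert (Ch : Cmod (RtoC (1 / 2)) = 1 / 2) by (rewrite Cmod_R; apply Rabs_pos_eq; lra).
specialize (B (RtoC (1 / 2)) ltac:(unfold in_disc; lra)).
rewrite Cmod_mono, Ch in B. eapply Rlt_le_trans; [|exact B].
apply Rmult_lt_0_compat; [apply pow_lt; lra | apply (proj1 Hw); lra].
Qed.

(** The bound on [Dop] controls [n |z|^(n-1) w], and [|z|^n <= |z|^(n-1)] on the disc lets both
    sides refer to the same exponent. *)
Lemma mono_norm_ratio (v w : R -> R) :
  vanishing v -> bounded_on Dop v w ->
  exists K, 0 < K /\ forall n M, bdd v (mono n) M -> INR n * weighted_norm w (mono n) <= K * M.
Proof.
intros Hv [K [HK HD]]. exists K. split; trivial. intros [|n] M B.
- simpl. rewrite Rmult_0_l. apply Rmult_le_pos; [lra|]. apply (bdd_ge_0 _ _ _ Hv B).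
- specialize (HD _ _ (analytic_mono _) B).
  assert (P : 0 < INR (S n)) by (apply lt_0_INR; lia).
  apply (Rmult_le_reg_l (/ INR (S n))); [apply Rinv_0_lt_compat; trivial|].
  rewrite <- Rmult_assoc, Rinv_l, Rmult_1_l by lra. apply bdd_weighted_norm.
  intros z Hz. specialize (HD z Hz). unfold Dop in HD.
  rewrite (is_C_derive_unique _ _ _ (is_cderive_mono n z)) in HD.
  rewrite Cmod_scale in HD by lra.
  apply (Rmult_le_reg_l (INR (S n))); trivial.
  rewrite <- (Rmult_assoc (INR (S n)) (/ INR (S n))), Rinv_r, Rmult_1_l by lra.
  rewrite Cmod_mono in *. destruct (Cmod_disc z Hz) as [Z0 Z1]. simpl pow.
  assert (Q : 0 <= Cmod z ^ n) by (apply pow_le; trivial).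
  assert (Q1 : 0 <= K * M) by (apply Rmult_le_pos; [lra | apply (bdd_ge_0 _ _ _ Hv B)]).
  nra.
Qed.

(** Normalised so that the [k]-th term has [w]-norm [2^-k], which is summable. The exponent [4^k]
    makes the ratio of the [v]-norm to the [w]-norm at least [4^k / K], which outweighs [2^-k] and
    leaves a [v]-norm of at least [2^k / K]. *)
Definition lac_coef (w : R -> R) (k : nat) : R := (1 / 2) ^ k / weighted_norm w (mono (4 ^ k)).

Definition lac_term (w : R -> R) (k : nat) : C -> C :=
  fscal (RtoC (lac_coef w k)) (mono (4 ^ k)).

Fixpoint lac_sum (w : R -> R) (n : nat) : C -> C :=
  match n with
  | O => fzero
  | S n => fadd (lac_sum w n) (lac_term w n)
  end.

Lemma lac_coef_pos (w : R -> R) (k : nat) : vanishing w -> 0 < lac_coef w k.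
Proof.
intros Hw. apply Rdiv_lt_0_compat; [apply pow_lt; lra | apply weighted_norm_mono_pos; trivial].
Qed.

Lemma lac_term_bdd (w : R -> R) (k : nat) : vanishing w -> bdd w (lac_term w k) ((1 / 2) ^ k).
Proof.
intros Hw. assert (P := weighted_norm_mono_pos w (4 ^ k) Hw).
replace ((1 / 2) ^ k) with (Cmod (RtoC (lac_coef w k)) * weighted_norm w (mono (4 ^ k))).
- apply bdd_fscal, Hinf_bdd, Hzero_Hinf, mono_Hzero; trivial.
- rewrite Cmod_R, Rabs_pos_eq by (apply Rlt_le, lac_coef_pos; trivial).
  unfold lac_coef. field. lra.
Qed.

Lemma lac_sum_Hzero (w : R -> R) (n : nat) : vanishing w -> carrier (Hzero w) (lac_sum w n).
Proof.
intros Hw. destruct (Hzero_linear w Hw) as (_ & L0 & LD & LS).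
induction n; [exact L0|]. apply LD; trivial. apply LS, mono_Hzero; trivial.
Qed.

Lemma lac_sum_tail (w : R -> R) (n j : nat) :
  vanishing w ->
  bdd w (fsub (lac_sum w (j + n)) (lac_sum w n)) (2 * ((1 / 2) ^ n - (1 / 2) ^ (j + n))).
Proof.
intros Hw. induction j as [|j IH].
- intros z _. unfold fsub. simpl. replace (lac_sum w n z - lac_sum w n z)%C with (RtoC 0) by ring.
  rewrite Cmod_0. lra.
- apply (bdd_ext _ (fadd (fsub (lac_sum w (j + n)) (lac_sum w n)) (lac_term w (j + n)))).
  + intros z _. simpl. unfold fsub, fadd. ring.
  + replace (2 * ((1 / 2) ^ n - (1 / 2) ^ (S j + n))) with
      (2 * ((1 / 2) ^ n - (1 / 2) ^ (j + n)) + (1 / 2) ^ (j + n)) by (simpl; lra).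
    apply bdd_fadd; trivial. apply lac_term_bdd; trivial.
Qed.

Lemma lac_sum_cauchy (w : R -> R) : vanishing w -> cauchy_in w (lac_sum w).
Proof.
intros Hw eps He.
assert (T : forall N n, (N <= n)%nat -> bdd w (fsub (lac_sum w n) (lac_sum w N)) (2 * (1 / 2) ^ N)).
{ intros N n Hn. replace n with ((n - N) + N)%nat by lia.
  eapply bdd_le; [|apply lac_sum_tail; trivial].
  assert (0 < (1 / 2) ^ (n - N + N)) by (apply pow_lt; lra). lra. }
destruct (pow_lt_1_zero (1 / 2) ltac:(rewrite Rabs_pos_eq; lra) (eps / 4) ltac:(lra)) as [N HN].
specialize (HN N (le_n _)). rewrite Rabs_pos_eq in HN by (apply pow_le; lra).
exists N. intros m n Hm Hn.
apply (bdd_ext _ (fsub (fsub (lac_sum w m) (lac_sum w N)) (fsub (lac_sum w n) (lac_sum w N)))).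
- intros z _. unfold fsub. ring.
- apply (bdd_le _ _ (2 * (1 / 2) ^ N + 2 * (1 / 2) ^ N)); [lra|].
  apply bdd_fsub; auto.
Qed.

Lemma Re_lac_term (w : R -> R) (k : nat) (r : R) :
  Re (lac_term w k (RtoC r)) = lac_coef w k * r ^ (4 ^ k).
Proof. unfold lac_term, fscal, mono. now rewrite <- RtoC_pow, <- RtoC_mult. Qed.

(** On the positive radius every term is a nonnegative real, so there is no cancellation and each
    single term bounds the partial sum from below. *)
Lemma Re_lac_sum_ge (w : R -> R) (r : R) (n k : nat) :
  vanishing w -> 0 <= r -> (k < n)%nat ->
  lac_coef w k * r ^ (4 ^ k) <= Re (lac_sum w n (RtoC r)).
Proof.
intros Hw Hr.
assert (P : forall j, 0 <= lac_coef w j * r ^ (4 ^ j)).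
{ intros j. apply Rmult_le_pos; [apply Rlt_le, lac_coef_pos; trivial | apply pow_le; trivial]. }
assert (Q : forall j, 0 <= Re (lac_sum w j (RtoC r))).
{ induction j as [|j IH]; [simpl; lra|].
  simpl lac_sum. unfold fadd. rewrite re_plus, Re_lac_term. specialize (P j). lra. }
induction n as [|n IH]; [lia|]. intros Hk.
simpl lac_sum. unfold fadd. rewrite re_plus, Re_lac_term.
destruct (Nat.eq_dec k n) as [->|Hkn].
- specialize (Q n). lra.
- specialize (P n). specialize (IH ltac:(lia)). lra.
Qed.

(* The lacunary series [sum_k 2^-k z^(4^k) / ||z^(4^k)||_w] lies in [Hzero w]; it is
   not in [Hinf v] because [||z^n||_v >= n ||z^n||_w / K]. *)
Lemma Hzero_not_Hinf (v w : R -> R) :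
  admissible v w -> exists f, carrier (Hzero w) f /\ ~ carrier (Hinf v) f.
Proof.
intros (Hv & Hw & HD & _ & Hder & _).
assert (A : forall n, analytic (lac_sum w n)) by (intros n; apply (lac_sum_Hzero w n Hw)).
destruct (cauchy_limit v w (lac_sum w)) as [f [Hf HL]]; trivial; [apply lac_sum_cauchy; trivial|].
exists f. split.
- apply Hzero_closed; trivial. intros eps He. destruct (HL eps He) as [N HN].
  exists (lac_sum w N). split; [apply lac_sum_Hzero; trivial | apply HN, le_n].
- intros H. apply Hinf_bdd in H. set (M := weighted_norm v f) in *.
  destruct (mono_norm_ratio v w Hv HD) as [K [HK HR]].
  (* The termwise lower bound passes to the limit; the tolerance [e * w r] becomes [e] after
     division by the weight. *)
  assert (Low : forall k r, 0 <= r < 1 -> lac_coef w k * r ^ (4 ^ k) <= Cmod (f (RtoC r))).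
  { intros k r Hr. assert (Cr : Cmod (RtoC r) = r) by (rewrite Cmod_R; apply Rabs_pos_eq; lra).
    assert (W : 0 < w r) by (apply (proj1 Hw); trivial).
    apply le_epsilon. intros e He. destruct (HL (e * w r)) as [N HN]; [apply Rmult_lt_0_compat; trivial|].
    set (n := Nat.max N (S k)). specialize (HN n ltac:(lia) (RtoC r)).
    rewrite Cr in HN. specialize (HN ltac:(unfold in_disc; lra)).
    apply Rmult_le_reg_r in HN; trivial.
    assert (S1 := Re_lac_sum_ge w r n k Hw (proj1 Hr) ltac:(lia)).
    assert (S2 := re_le_Cmod (lac_sum w n (RtoC r))).
    assert (S3 := Rle_abs (Re (lac_sum w n (RtoC r)))).
    assert (T := Cmod_triangle (fsub (lac_sum w n) f (RtoC r)) (f (RtoC r))).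
    replace (fsub (lac_sum w n) f (RtoC r) + f (RtoC r))%C with (lac_sum w n (RtoC r)) in T
      by (unfold fsub; ring). lra. }
  (* The modulus of a monomial is radial, so [Low] on the positive radius bounds the whole [v]-norm
     of [z^(4^k)] by [M / lac_coef w k]. The norm ratio then gives [4^k N <= K M 2^k N], with [N]
     the [w]-norm. *)
  assert (Up : forall k, 2 ^ k <= K * M).
  { intros k. assert (Cp := lac_coef_pos w k Hw).
    assert (B : bdd v (mono (4 ^ k)) (M / lac_coef w k)).
    { intros z Hz. destruct (Cmod_disc z Hz) as [Z0 Z1]. rewrite Cmod_mono.
      specialize (Low k (Cmod z) (conj Z0 Z1)).
      assert (Cr : Cmod (RtoC (Cmod z)) = Cmod z) by (rewrite Cmod_R; apply Rabs_pos_eq; trivial).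
      specialize (H (RtoC (Cmod z))). rewrite Cr in H. specialize (H ltac:(unfold in_disc; lra)).
      assert (V : 0 < v (Cmod z)) by (apply (proj1 Hv); lra).
      apply (Rmult_le_reg_l (lac_coef w k)); trivial.
      replace (lac_coef w k * (M / lac_coef w k)) with M by (field; lra).
      rewrite <- Rmult_assoc. eapply Rle_trans; [|exact H]. apply Rmult_le_compat_r; lra. }
    specialize (HR _ _ B). assert (Np := weighted_norm_mono_pos w (4 ^ k) Hw).
    unfold lac_coef in HR. set (N := weighted_norm w (mono (4 ^ k))) in *.
    rewrite pow_INR in HR. replace (INR 4) with (2 * 2) in HR by (simpl; lra).
    rewrite Rpow_mult_distr in HR.
    assert (P2 : 0 < 2 ^ k) by (apply pow_lt; lra).
    replace ((1 / 2) ^ k) with (/ 2 ^ k) in HR by (unfold Rdiv; rewrite Rmult_1_l, pow_inv; trivial).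
    replace (K * (M / (/ 2 ^ k / N))) with (K * M * (2 ^ k * N)) in HR by (field; lra).
    apply (Rmult_le_reg_r (2 ^ k * N)); [apply Rmult_lt_0_compat; trivial|]. lra. }
  destruct (Pow_x_infinity 2 ltac:(rewrite Rabs_pos_eq; lra) (K * M + 1)) as [k Hk].
  specialize (Hk k (le_n _)). rewrite Rabs_pos_eq in Hk by (apply pow_le; lra).
  specialize (Up k). lra.
Qed.

(** The factor [1 - Cmod z] of [w] tends to 0, while the remaining product is at most the [v]-norm
    of [f]. *)
Lemma Hinf_Hzero (v w : R -> R) (f : C -> C) :
  vanishing v -> (forall r, 0 <= r < 1 -> w r = (1 - r) * v r) ->
  carrier (Hinf v) f -> carrier (Hzero w) f.
Proof.
intros Hv Hw H. split; [apply H|]. intros eps He.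
assert (HM := weighted_norm_ge_0 v f Hv H). apply Hinf_bdd in H.
set (M := weighted_norm v f) in *.
exists (1 - eps / (M + 1)). assert (Q : 0 < eps / (M + 1)) by (apply Rdiv_lt_0_compat; lra).
split; [lra|]. intros z Hz. destruct (Cmod_disc z (proj2 Hz)) as [Z0 Z1].
rewrite Hw by lra. specialize (H z Z1).
assert (Q1 : (1 - Cmod z) * (M + 1) < eps).
{ replace eps with (eps / (M + 1) * (M + 1)) by (field; lra). apply Rmult_lt_compat_r; lra. }
replace (Cmod (f z) * ((1 - Cmod z) * v (Cmod z))) with
  ((1 - Cmod z) * (Cmod (f z) * v (Cmod z))) by ring. nra.
Qed.

(** * From the hypotheses to the theorem *)

Lemma weight_vanishing (v : R -> R) :
  is_weight v -> filterlim v (at_left 1) (locally 0) -> vanishing v.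
Proof.
intros (Hp & Hm & _) Hl. split; [|split]; trivial. intros eps He.
assert (L := proj1 (filterlim_locally v 0) Hl (mkposreal eps He)).
destruct L as [d Hd]. exists (Rmax 0 (1 - d)).
assert (Dp := cond_pos d). split; [split; [apply Rmax_l | apply Rmax_lub_lt; lra]|].
intros r Hr. generalize (Rmax_l 0 (1 - d)) (Rmax_r 0 (1 - d)). intros.
specialize (Hd r). assert (Hb : ball 1 d r).
{ change (Rabs (r - 1) < d). rewrite Rabs_left by lra. lra. }
specialize (Hd Hb (proj2 Hr)). change (Rabs (v r - 0) < eps) in Hd.
apply Rabs_def2 in Hd. lra.
Qed.

Lemma vanishing_scaled (v w : R -> R) :
  vanishing v -> (forall r, 0 <= r < 1 -> w r = (1 - r) * v r) -> vanishing w.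
Proof.
intros (Hp & Hm & Hl) Hw. split; [|split].
- intros r Hr. rewrite Hw by trivial. apply Rmult_lt_0_compat; [lra | auto].
- intros r s Hr Hrs Hs. rewrite !Hw by lra.
  apply Rmult_le_compat; [lra | apply Rlt_le, Hp; lra | lra | apply Hm; trivial].
- intros eps He. destruct (Hl eps He) as [r [Hr H]]. exists r; split; trivial.
  intros s Hs. specialize (H s Hs). assert (0 < v s) by (apply Hp; lra). rewrite Hw by lra. nra.
Qed.

Lemma admissible_intro (v w : R -> R) :
  vanishing v -> vanishing w ->
  continuous_operator Dop (Hinf v) (Hinf w) -> continuous_operator Jop (Hinf w) (Hinf v) ->
  admissible v w.
Proof.
intros Hv Hw HD HJ. split; [|split; [|split; [|split; [|split]]]]; trivial.
- apply continuous_operator_bounded; trivial. apply C_derive_fscal.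
- apply continuous_operator_bounded; trivial. apply integral_to_fscal.
- exact (analytic_C_derive v w Hv (proj1 HD)).
- exact (analytic_Jop v w Hw (proj1 HJ)).
Qed.

Theorem proposition4p2 (v w : R -> R)
  (hv : is_weight v)
  (hlog : log_convex v)
  (hlim : filterlim v (at_left 1) (locally 0))
  (hw : forall r : R, 0 <= r < 1 -> w r = (1 - r) * v r)
  (hD : continuous_operator Dop (Hinf v) (Hinf w))
  (hJ : continuous_operator Jop (Hinf w) (Hinf v))
  (t : R) (ht : 0 <= t < 1) :
  (banach_eq (optimal_domain (Volterra_op (g_sym t)) (Hinf v))
             (optimal_domain (Cesaro_op t) (Hinf v)) /\
   banach_eq (optimal_domain (Cesaro_op t) (Hinf v)) (Hinf w)) /\
  (banach_eq (optimal_domain (Volterra_op (g_sym t)) (Hzero v))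
             (optimal_domain (Cesaro_op t) (Hzero v)) /\
   banach_eq (optimal_domain (Cesaro_op t) (Hzero v)) (Hzero w)) /\
  (proper_subspace_of (Hinf v) (optimal_domain (Cesaro_op t) (Hzero v)) /\
   subspace_of (Hzero v) (Hinf v) /\
   proper_subspace_of (Hzero v) (optimal_domain (Cesaro_op t) (Hzero v))).
Proof.
assert (Hv := weight_vanishing v hv hlim). assert (Hw := vanishing_scaled v w Hv hw).
assert (Ha := admissible_intro v w Hv Hw hD hJ).
assert (Ha' := Ha). destruct Ha' as (_ & _ & HD & HJ & Hder & Jan).
assert (BI := Hinf_banach v w Hv Hw HD Hder). assert (BZ := Hzero_banach v w Hv Hw HD Hder).
assert (Inf : banach_eq (optimal_domain (Volterra_op (g_sym t)) (Hinf v))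
             (optimal_domain (Cesaro_op t) (Hinf v)) /\
   banach_eq (optimal_domain (Cesaro_op t) (Hinf v)) (Hinf w)).
{ apply banach_eq_of_common; trivial.
  - apply (optimal_domain_Volterra v w); auto; [apply Hinf_ext|].
    intros f Hf. apply Hinf_Jop_kmul; trivial.
  - apply (optimal_domain_Cesaro v w); auto; [apply Hinf_ext|].
    intros f Hf. rewrite (Hinf_radial_mean v w) by trivial. apply Hinf_Jop_kmul; trivial. }
assert (Zero : banach_eq (optimal_domain (Volterra_op (g_sym t)) (Hzero v))
             (optimal_domain (Cesaro_op t) (Hzero v)) /\
   banach_eq (optimal_domain (Cesaro_op t) (Hzero v)) (Hzero w)).
{ assert (ZI := fun f => Hzero_Hinf v f Hv). assert (ZI' := fun f => Hzero_Hinf w f Hw).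
  apply banach_eq_of_common; trivial.
  - apply (optimal_domain_Volterra v w); auto; [apply Hzero_ext|].
    intros f Hf. apply Hzero_Jop_kmul; trivial.
  - apply (optimal_domain_Cesaro v w); auto; [apply Hzero_ext|].
    intros f Hf. assert (Hk := analytic_kmul t f ht Hf).
    rewrite Hzero_radial_mean by (trivial; apply Jan; trivial). apply Hzero_Jop_kmul; trivial. }
split; [exact Inf|]. split; [exact Zero|].
(* By the little-o identity, membership in the Cesaro domain can be read as membership in [Hzero w],
   so what remains only compares weighted spaces. *)
destruct Zero as [_ (BC & _ & Car & _)].
assert (LI := Hinf_linear v Hv). assert (LZ := Hzero_linear v Hv).
assert (Sub : forall f, carrier (Hinf v) f -> carrier (optimal_domain (Cesaro_op t) (Hzero v)) f).
{ intros f Hf. apply Car, (Hinf_Hzero v w); trivial. }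
(* One function settles both strict inclusions, since [Hzero v] is contained in [Hinf v]. *)
destruct (Hzero_not_Hinf v w Ha) as [f [Hf Nf]].
split; [|split].
- split; [split; [trivial | split; [apply BC | trivial]]|].
  exists f. split; [apply Car, Hf | exact Nf].
- split; [trivial | split; [trivial|]]. intros g. apply Hzero_Hinf; trivial.
- split; [split; [trivial | split; [apply BC|]]|].
  + intros g Hg. apply Sub, Hzero_Hinf; trivial.
  + exists f. split; [apply Car, Hf|]. intros Z. apply Nf, Hzero_Hinf; trivial.
Qed.
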